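(* Let $K,H$ be Hilbert spaces (both real or both complex) with $\dim K<\infty$, and let $\mathcal{B}$ be the open unit ball of $L(K,H)$, with the metric $\rho$. A finite set $\mathcal{E}$ of commuting $\rho$-nonexpansive maps of $\mathcal{B}$ (into itself) has a common fixed point in $\mathcal{B}$ if and only if $\mathcal{E}$ has a non-empty invariant set separated from the boundary of $\mathcal{B}$.
   Context: $L(K,H)$ is the Banach space of all bounded linear operators from $K$ to $H$ with the operator norm. For $A\in\mathcal{B}$ the Möbius transformation $M_A:\mathcal{B}\to\mathcal{B}$ is $$M_A(X)=(1-AA^* )^{-1/2}(A+X)(1+A^*X)^{-1}(1-A^*A)^{1/2};$$ it satisfies $M_A^{-1}=M_{-A}$. The metric $\rho$ on $\mathcal{B}$ is defined by $\rho(A,B)=\tanh^{-1}(\|M_{-A}(B)\|)$ (in the complex case it is the Carathéodory distance of $\mathcal{B}$). A map $g:\mathcal{B}\to\mathcal{B}$ is $\rho$-nonexpansive if $\rho(g(X),g(Y))\le\rho(X,Y)$ for all $X,Y\in\mathcal{B}$. A set $F\subset\mathcal{B}$ is invariant for $\mathcal{E}$ if $g(F)\subset F$ for all $g\in\mathcal{E}$. A subset of $\mathcal{B}$ is separated from the boundary if there is $r<1$ such that all its elements have norm at most $r$ (equivalently, it is $\rho$-bounded). *)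

(* Defs.v *)
From HB Require Import structures.
From mathcomp Require Import all_boot all_order all_algebra.
From mathcomp Require Import sesquilinear complex.
From mathcomp Require Import all_classical all_reals all_analysis.

Set Implicit Arguments.
Unset Strict Implicit.
Unset Printing Implicit Defensive.

Import Order.TTheory GRing.Theory Num.Theory.
Import numFieldNormedType.Exports.
Local Open Scope classical_set_scope.
Local Open Scope ring_scope.

(* The scalar field is either R or R[i]; norms and inner products of a vector
   space over R[i] are R[i]-valued, and [real_part] brings norms back to R. *)
Inductive scalar_kind := RealScalars | ComplexScalars.

Definition scalars (R : realType) (k : scalar_kind) : numFieldType :=
  match k with RealScalars => R | ComplexScalars => complex R end.

Definition conjugation (R : realType) (k : scalar_kind) :
    {rmorphism scalars R k -> scalars R k} :=
  match k with
  | RealScalars => idfun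
  | ComplexScalars => @conjc R
  end.

Definition real_part (R : realType) (k : scalar_kind) : scalars R k -> R :=
  match k with
  | RealScalars => idfun
  | ComplexScalars => @complex.Re R
  end.

(* The inner product is linear in its first argument. *)
Record hilbertType (R : realType) (k : scalar_kind) := HilbertType {
  hilbert_space :> completeNormedModType (scalars R k);
  inner : {dot hilbert_space for conjugation R k};
  inner_norm : forall x : hilbert_space, inner x x = `|x| ^+ 2
}.

Definition finite_dimensional (R : realType) (k : scalar_kind)
    (K : hilbertType R k) : Prop :=
  exists (n : nat) (e : 'I_n -> K),
    forall x : K, exists c : 'I_n -> scalars R k, x = \sum_(i < n) c i *: e i.

Section Operators.
Context (R : realType) (k : scalar_kind).
Implicit Types K H : hilbertType R k.

Definition bounded_operator K H (f : K -> H) : Prop :=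
  exists M : scalars R k, forall x : K, `|f x| <= M * `|x|.

Definition opnorm K H (f : K -> H) : R :=
  sup [set real_part `|f x| | x in [set x : K | `|x| <= 1]].

(* By Riesz, for a bounded linear f the set below is a singleton. *)
Definition adjoint K H (f : K -> H) (y : H) : K :=
  xget 0 [set z : K | forall x : K, inner H (f x) y = inner K x z].

(* Self-adjointness is automatic only over the complex scalars. *)
Definition positive_operator H (S : H -> H) : Prop :=
  [/\ linear S,
      bounded_operator S,
      forall x y : H, inner H (S x) y = inner H x (S y)
    & forall x : H, 0 <= inner H (S x) x].

(* The unique positive square root, when T is a positive operator. *)
Definition opsqrt H (T : H -> H) : H -> H :=
  xget (fun=> 0) [set S : H -> H | positive_operator S /\ S \o S = T].

(* The two-sided inverse, when T is bijective. *)
Definition opinv H (T : H -> H) : H -> H := 'pinv_(fun=> 0) setT T.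

Definition moebius K H (A X : K -> H) : K -> H :=
  opinv (opsqrt (idfun \- (A \o adjoint A)))
  \o (A \+ X)
  \o opinv (idfun \+ (adjoint A \o X))
  \o opsqrt (idfun \- (adjoint A \o A)).

Record unit_ball K H := UnitBall {
  ball_operator :> {linear K -> H};
  ball_bounded : bounded_operator ball_operator;
  ball_opnorm : opnorm ball_operator < 1
}.

Definition artanh (t : R) : R := ln ((1 + t) / (1 - t)) / 2.

Definition rho K H (A B : unit_ball K H) : R :=
  artanh (opnorm (moebius (\- A) B)).

Definition rho_nonexpansive K H (g : unit_ball K H -> unit_ball K H) : Prop :=
  forall X Y : unit_ball K H, rho (g X) (g Y) <= rho X Y.

Definition invariant_set K H (E : set (unit_ball K H -> unit_ball K H))
    (F : set (unit_ball K H)) : Prop :=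
  forall g, E g -> g @` F `<=` F.

Definition separated_from_boundary K H (F : set (unit_ball K H)) : Prop :=
  exists2 r : R, r < 1 & forall X, F X -> opnorm X <= r.

End Operators.

(* Main.v *)
Require Import Defs.
From HB Require Import structures.
From mathcomp Require Import all_boot all_order all_algebra.
From mathcomp Require Import sesquilinear complex ring lra.
From mathcomp Require Import all_classical all_reals all_analysis.

Set Implicit Arguments.
Unset Strict Implicit.
Unset Printing Implicit Defensive.

Import Order.TTheory GRing.Theory Num.Theory.
Import numFieldNormedType.Exports.
Local Open Scope classical_set_scope.
Local Open Scope ring_scope.

(** A common fixed point X gives the invariant set {X}. The converse is a
normal-structure argument in the spirit of Kirk, with convexity taken in the
ambient vector space.

Everything rests on a formula for rho free of square roots and inverses. Write
D_X(v) = |v|^2 - |Xv|^2 and let <.,.> be the real part of the inner product.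
For s >= 0, sinh^2 rho(X,Y) <= s if and only if, for all v and w in K,
    (<v,w> - <Yv,Xw>)^2 <= (1 + s) D_Y(v) D_X(w)
([sinhsq_le], resting on [moebius_opnorm_le]). It says that the pseudo-Euclidean
form of signature (K, H) satisfies a quantified reverse Cauchy-Schwarz
inequality on the graphs of X and Y. The formula shows at once that rho is
symmetric, that rho-balls are convex and closed, and that on sets separated
from the boundary sinh^2 rho is Lipschitz in the operator norm. The argument
works with sinh^2 rho, which has the same nonexpansive maps as rho.

The first step replaces the invariant set F by a convex one. Fix X0 in F and
let M consist of the X whose asymptotic distance to the orbit of X0, along the
commutative monoid generated by the maps, is at most a bound for the diameter
of F ([asymptotic_ball]). Since the maps are nonexpansive and commute, M is
stable, convex, closed and separated from the boundary.

The second step is a fixed point theorem on M for a finite commuting family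
([common_fixed_point]). It needs two properties of intersections of balls.

Compactness: a chain of nonempty closed convex sets separated from the boundary
has a common point ([midconvex_chain_compact]). As K is finite dimensional, a
Hilbert-Schmidt norm is available on the operators, and points of almost
minimal norm in smaller and smaller sets of the chain form a Cauchy sequence by
the parallelogram law.

Normal structure: a convex set D of diameter r > 0 lies in a ball of smaller
radius centred in D ([midconvex_normal_structure]). Otherwise, for a midpoint X
of finitely many points A of D there are Y in D and unit vectors v, w that
almost violate the inequality above. The strict convexity of |Xv|^2 then forces
all the Av to be almost equal. Adding Y to the list and repeating yields a
sequence of unit vectors v; two of them are close because the unit sphere of K
is totally bounded, and the earlier Y then almost agrees at its v with a fixed
point A0 of D. But operators that agree at v satisfy the inequality with s = 0,
so they are far from violating it with s near sinh^2 of the diameter. *)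

(** * Fixed points of commuting nonexpansive maps *)
Section BallIntersections.
Context (R : realType) (T : Type) (d : T -> T -> R).
Context (d_sym : forall x y, d x y = d y x).
Context (d_separated : forall x y, d x y <= 0 -> x = y).

(** The set [c] lists closed balls as pairs (centre, radius); keeping the
constraints, rather than the set they cut out, makes chains and maximality
amenable to Zorn's lemma. *)
Definition ball_meet (c : set (T * R)) : set T :=
  [set x | forall p, c p -> d p.1 x <= p.2].

Definition centered (A : set T) (c : set (T * R)) : Prop :=
  forall p, c p -> A p.1.

Definition chain_compact (A : set T) : Prop :=
  forall C : set (set (T * R)),
    total_on C subset -> C !=set0 ->
    (forall c, C c -> centered A c /\ A `&` ball_meet c !=set0) ->
    A `&` ball_meet (\bigcup_(c in C) c) !=set0.

(** The number [r] need not be the exact diameter; when it is not, the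
conclusion is immediate. *)
Definition normal_structure (A : set T) : Prop :=
  forall c, centered A c -> A `&` ball_meet c !=set0 ->
  forall r, 0 < r ->
    (forall x y, (A `&` ball_meet c) x -> (A `&` ball_meet c) y -> d x y <= r) ->
  exists x, (A `&` ball_meet c) x /\ exists2 s, s < r &
    forall y, (A `&` ball_meet c) y -> d x y <= s.

Definition d_bounded (A : set T) : Prop :=
  exists b, forall x y, A x -> A y -> d x y <= b.

Definition nonexpansive_on (A : set T) (g : T -> T) : Prop :=
  forall x y, A x -> A y -> d (g x) (g y) <= d x y.

Definition stable (A : set T) (g : T -> T) : Prop := forall x, A x -> A (g x).

Lemma ball_meetS c c' : c `<=` c' -> ball_meet c' `<=` ball_meet c.
Proof. by move=> cc' x c'x p /cc'; exact: c'x. Qed.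

Lemma ball_meetU c c' x :
  ball_meet c x -> ball_meet c' x -> ball_meet (c `|` c') x.
Proof. by move=> cx c'x p [/cx|/c'x]. Qed.

(** Kirk's argument. Zorn's lemma gives a maximal admissible family of
constraints, that is a minimal stable ball intersection D. The ball hull of the
image of D is stable too, so every ball containing g(D) contains D. The points
of D within a given distance of all of D therefore form a stable set, which
minimality makes all of D; normal structure forbids this unless D is a point. *)
Lemma fixed_point_of_stable_ball_meet A g c :
  chain_compact A -> normal_structure A -> d_bounded A ->
  nonexpansive_on A g ->
  centered A c -> A `&` ball_meet c !=set0 -> stable (A `&` ball_meet c) g ->
  exists x, (A `&` ball_meet c) x /\ g x = x.
Proof.
move=> cptA nsA [b bA] neg cA c0 cg.
pose admissible e := [/\ centered A e, A `&` ball_meet e !=set0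
                       & stable (A `&` ball_meet e) g].
pose P e := admissible (c `|` e).
have [|e [[eA [x0 ex0] eg] emax]] := @Zorn_bigcup _ P.
  move=> F FP Ftot.
  have [F0|/eqP/set0P[e1 Fe1]] := pselect (F = set0).
    by rewrite F0 bigcup_set0 /P setU0.
  pose C := [set c `|` e | e in F].
  have CE : \bigcup_(e in C) e = c `|` \bigcup_(e in F) e.
    apply/seteqP; split => p.
      by move=> [_ [e Fe <-]] [cp|ep]; [left|right; exists e].
    move=> [cp|[e Fe ep]]; first by exists (c `|` e1); [exists e1|left].
    by exists (c `|` e); [exists e|right].
  rewrite /P -CE; split.
  - by move=> p [_ [e Fe <-]]; case: (FP _ Fe) => + _ _; apply.
  - apply: cptA.
    + move=> _ _ [e Fe <-] [e' Fe' <-].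
      by case: (Ftot _ _ Fe Fe') => ee'; [left|right]; apply: setUS.
    + by exists (c `|` e1); exists e1.
    + by move=> _ [e Fe <-]; case: (FP _ Fe).
  - move=> x [Ax Cx].
    have step e : F e -> (A `&` ball_meet (c `|` e)) (g x).
      move=> Fe; case: (FP _ Fe) => _ _; apply; split => //.
      by move=> p ep; apply: Cx; exists (c `|` e) => //; exists e.
    split; first by case: (step _ Fe1).
    move=> p [_ [e Fe <-]] ep.
    by case: (step _ Fe) => _; apply.
set k := c `|` e in eA ex0 eg; set D := A `&` ball_meet k in ex0 eg.
have kmax k' : k `<=` k' -> admissible k' -> k' `<=` k.
  move=> kk' ak' p k'p; apply: contrapT => nkp.
  apply: (emax k'); last first.
    rewrite /P (_ : c `|` k' = k') //; apply/setUidPr => q cq.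
    by apply: kk'; left.
  split; first by move=> q eq; apply: kk'; right.
  by move=> /(_ _ k'p) ep; apply: nkp; right.
have Dc : D `<=` A `&` ball_meet c.
  by move=> x [Ax kx]; split => //; apply: ball_meetS kx; apply: subsetUl.
(* Minimality applied to the ball hull of g(D). *)
have hull p : A p.1 -> (forall y, D y -> d p.1 (g y) <= p.2) ->
    forall y, D y -> d p.1 y <= p.2.
  move=> Ap gp y [Ay ky].
  pose k' := k `|` [set q | A q.1 /\ forall y, D y -> d q.1 (g y) <= q.2].
  have gk' z : D z -> (A `&` ball_meet k') (g z).
    move=> Dz; have [Agz kgz] := eg _ Dz; split => //.
    by apply: ball_meetU => // q [_]; apply.
  apply: ky; apply: (kmax k').
  - exact: subsetUl.
  - split.
    + by move=> q [/eA//|[]].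
    + by exists (g x0); apply: gk'.
    + move=> z [Az k'z]; apply: gk'; split => //.
      by apply: ball_meetS k'z; apply: subsetUl.
  - by right.
pose dist := [set d x.1 x.2 | x in D `*` D].
have supD : has_sup dist.
  split; first by exists (d x0 x0); exists (x0, x0).
  by exists b => _ [[x y] [[/= Ax _] [Ay _]] <-]; exact: bA.
have dsup x y : D x -> D y -> d x y <= sup dist.
  by move=> Dx Dy; apply: ub_le_sup; [case: supD|exists (x, y)].
have [sup0|sup0] := leP (sup dist) 0.
  exists x0; split; first exact: Dc.
  apply/esym/d_separated; apply: le_trans sup0.
  by apply: dsup => //; exact: eg.
have [x [Dx [s ssup xs]]] := nsA _ eA (ex_intro _ _ ex0) _ sup0 dsup.
(* Minimality applied to the set of points of D within s of all of D. *)
pose k' := k `|` [set q | D q.1 /\ q.2 = s].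
have kk' : k' `<=` k.
  apply: kmax; first exact: subsetUl.
  split.
  - by move=> q [/eA//|[[]]].
  - exists x; have [Ax kx] := Dx; split => //; apply: ball_meetU => // q [Dq ->].
    by rewrite d_sym; exact: xs.
  - move=> z [Az k'z].
    have Dz : D z by split => //; apply: ball_meetS k'z; apply: subsetUl.
    have [Agz kgz] := eg _ Dz; split => //; apply: ball_meetU => // q [Dq ->].
    rewrite d_sym; apply: (hull (g z, s)) => //= y Dy.
    apply: le_trans (neg _ _ Az _) _; first by case: Dy.
    by rewrite d_sym; apply: (k'z (y, s)); right.
suff : sup dist <= s by rewrite leNgt ssup.
apply: ge_sup; first by case: supD.
move=> _ [[y z] [/= Dy [Az kz]] <-].
by apply: (kz (y, s)); apply: kk'; right.
Qed.

(** A ball intersection centred at fixed points is stable, so it contains a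
fixed point. This lets the fixed point set inherit compactness and normal
structure, although it is no ball intersection itself. *)
Lemma fixed_points_retract A g :
  chain_compact A -> normal_structure A -> d_bounded A ->
  stable A g -> nonexpansive_on A g ->
  forall c, centered (A `&` [set x | g x = x]) c -> A `&` ball_meet c !=set0 ->
  exists x, (A `&` [set x | g x = x] `&` ball_meet c) x.
Proof.
move=> cptA nsA bA sg ng c cF c0.
have [||x [[Ax cx] gx]] := fixed_point_of_stable_ball_meet cptA nsA bA ng _ c0.
- by move=> p /cF[].
- move=> x [Ax cx]; split; first exact: sg.
  move=> p cp; have [Ap gp] := cF _ cp; rewrite -gp.
  by apply: le_trans (ng _ _ Ap Ax) _; exact: cx.
- by exists x.
Qed.

(** Induction on the family: the remaining maps preserve the fixed point set B
of the first one. For normal structure in B, a set D cut out in B is enlarged to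
its ball hull in A, which has the same diameter; the better centre found there
is moved back into B by the retraction property. *)
Lemma common_fixed_point (gs : list (T -> T)) A :
  A !=set0 -> chain_compact A -> normal_structure A -> d_bounded A ->
  (forall g, List.In g gs -> stable A g /\ nonexpansive_on A g) ->
  (forall f g, List.In f gs -> List.In g gs -> f \o g = g \o f) ->
  exists2 x, A x & forall g, List.In g gs -> g x = x.
Proof.
elim: gs A => [|g gs IH] A A0 cptA nsA bA sn com; first by case: A0 => x; exists x.
have [sg ng] := sn g (or_introl erefl).
have retract := fixed_points_retract cptA nsA bA sg ng.
set B := A `&` [set x | g x = x] in retract.
have BA : B `<=` A by move=> x [].
have [||||||x [Ax gx] gsx] := IH B.
- have [||x [Bx _]] := retract set0 => //; last by exists x.
  by have [x Ax] := A0; exists x; split => // p.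
- move=> C Ctot C0 CP.
  have [||x [Bx Cx]] := retract (\bigcup_(c in C) c); last by exists x.
    by move=> p [c /CP[cB _]] /cB.
  apply: cptA => // c /CP[cB [x [Bx cx]]]; split; first by move=> p /cB /BA.
  by exists x; split=> //; exact: BA.
- move=> c cB; set D := B `&` ball_meet c => -[x0 Dx0] r r0 Dr.
  pose k := [set p | A p.1 /\ forall y, D y -> d p.1 y <= p.2].
  have ck : c `<=` k.
    by move=> p cp; split; [apply/BA/cB|move=> y [_]; apply].
  have Dk : D `<=` A `&` ball_meet k.
    by move=> x Dx; split; [case: Dx => /BA|move=> p [_]; exact].
  have [|||x [[Ax kx] [s sr xs]]] := nsA k _ _ r r0.
  + by move=> p [].
  + by exists x0; apply: Dk.
  + move=> x y [Ax kx] [Ay ky]; rewrite d_sym; apply: (kx (y, r)); split => //= z Dz.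
    rewrite d_sym; apply: (ky (z, r)); split => /= [|w Dw]; last exact: Dr.
    by case: Dz => /BA.
  have [||y [By cy]] := retract (c `|` [set q | D q.1 /\ q.2 = s]).
  + by move=> p [/cB//|[[]]].
  + exists x; split => //; apply: ball_meetU; first exact: ball_meetS kx.
    by move=> q [Dq ->]; rewrite d_sym; apply: xs; apply: Dk.
  exists y; split.
    by split => //; apply: ball_meetS cy; apply: subsetUl.
  exists s => // z Dz; rewrite d_sym.
  by apply: (cy (z, s)); right.
- by case: bA => b bA; exists b => x y /BA Ax /BA Ay; exact: bA.
- move=> h hgs; have [sh nh] := sn h (or_intror hgs); split; last first.
    by move=> x y /BA Ax /BA Ay; exact: nh.
  move=> x [Ax gx]; split; first exact: sh.
  have := com g h (or_introl erefl) (or_intror hgs).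
  by move=> /(congr1 (@^~ x)) /= ->; rewrite gx.
- by move=> f h fgs hgs; apply: com; right.
exists x => // h [<-//|]; exact: gsx.
Qed.

End BallIntersections.

(** * Real and complex Hilbert spaces as real inner product spaces *)
Section Scalars.
Context (R : realType) (k : scalar_kind).
Implicit Types (a b : R) (z w : scalars R k).

Definition of_real : R -> scalars R k :=
  match k with RealScalars => id | ComplexScalars => fun a => (a%:C)%C end.

(** Zero over the reals, so that the decomposition of a scalar into its real
and imaginary parts reads the same in both cases. *)
Definition imag : scalars R k :=
  match k with RealScalars => 0 | ComplexScalars => ('i)%C end.

Definition imag_part : scalars R k -> R :=
  match k with RealScalars => fun=> 0 | ComplexScalars => @complex.Im R end.

Lemma scalar_decomp z : z = of_real (real_part z) + of_real (imag_part z) * imag.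
Proof.
rewrite /of_real /real_part /imag_part /imag; case: k z => z /=.
  by rewrite mulr0 addr0.
by case: z => x y; rewrite [LHS]complexE mulrC.
Qed.

Lemma of_realD a b : of_real (a + b) = of_real a + of_real b.
Proof. by rewrite /of_real; case: k => //=; rewrite rmorphD. Qed.
Lemma of_realM a b : of_real (a * b) = of_real a * of_real b.
Proof. by rewrite /of_real; case: k => //=; rewrite rmorphM. Qed.
Lemma of_real0 : of_real 0 = 0.
Proof. by rewrite /of_real; case: k. Qed.
Lemma of_real1 : of_real 1 = 1.
Proof. by rewrite /of_real; case: k. Qed.
Lemma of_real_le a b : (of_real a <= of_real b) = (a <= b).
Proof. by rewrite /of_real; case: k => //=; rewrite lecR. Qed.
Lemma of_real_lt a b : (of_real a < of_real b) = (a < b).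
Proof. by rewrite /of_real; case: k => //=; rewrite ltcR. Qed.
Lemma real_partD z w : real_part (z + w) = real_part z + real_part w.
Proof. by rewrite /real_part; case: k z w => //= [[? ?] [? ?]]. Qed.
Lemma real_partM a z : real_part (of_real a * z) = a * real_part z.
Proof.
rewrite /real_part /of_real; case: k z => //= -[x y] /=.
by rewrite mul0r subr0.
Qed.
Lemma real_part_of_real a : real_part (of_real a) = a.
Proof. by rewrite /real_part /of_real; case: k. Qed.
Lemma ge0_real_part z : 0 <= z -> z = of_real (real_part z).
Proof.
rewrite /real_part /of_real; case: k z => //= -[x y].
by rewrite lecE /= => /andP[/eqP -> _].
Qed.
Lemma le_real_part z w : z <= w -> real_part z <= real_part w.
Proof.
rewrite /real_part; case: k z w => //= -[x y] [u v].
by rewrite lecE /= => /andP[].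
Qed.
Lemma real_part_conj z : real_part (conjugation R k z) = real_part z.
Proof. by rewrite /real_part /conjugation; case: k z => //= -[]. Qed.
Lemma real_part_eq z w : real_part z = real_part w ->
  real_part (imag * z) = real_part (imag * w) -> z = w.
Proof.
rewrite /real_part /imag; case: k z w => //= -[x y] [u v] /= -> h.
by congr (_ +i* _)%C; lra.
Qed.
Lemma conj_fix_ge0 z : conjugation R k z = z -> 0 <= real_part z -> 0 <= z.
Proof.
rewrite /real_part /conjugation; case: k z => //= -[x y] /= [h] x0.
by rewrite lecE /= x0 andbT; apply/eqP; lra.
Qed.

End Scalars.

Section RealInner.
Context (R : realType) (k : scalar_kind) (V : hilbertType R k).
Implicit Types (x y z : V) (a b : R).

Definition ip x y : R := real_part (inner V x y).
Definition nm x : R := real_part `|x|.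
Definition rscale a x : V := of_real k a *: x.

Lemma norm_nm x : `|x| = of_real k (nm x).
Proof. exact: ge0_real_part. Qed.
Lemma ipDl x y z : ip (x + y) z = ip x z + ip y z.
Proof. by rewrite /ip linearDl real_partD. Qed.
Lemma ipDr x y z : ip z (x + y) = ip z x + ip z y.
Proof. by rewrite /ip linearDr real_partD. Qed.
Lemma ipC x y : ip x y = ip y x.
Proof. by rewrite /ip hermC expr0 mul1r real_part_conj. Qed.
Lemma ipZl a x y : ip (rscale a x) y = a * ip x y.
Proof. by rewrite /ip linearZl_LR real_partM. Qed.
Lemma ipZr a x y : ip y (rscale a x) = a * ip y x.
Proof. by rewrite ipC ipZl ipC. Qed.
Lemma ipNl x y : ip (- x) y = - ip x y.
Proof.
have : ip (- x + x) y = 0 by rewrite addNr /ip linear0l -(of_real0 R k) real_part_of_real.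
by rewrite ipDl; lra.
Qed.
Lemma ipNr x y : ip y (- x) = - ip y x.
Proof. by rewrite ipC ipNl ipC. Qed.
Lemma ip0l x : ip 0 x = 0.
Proof. by rewrite -(subrr x) ipDl ipNl subrr. Qed.
Lemma ip0r x : ip x 0 = 0.
Proof. by rewrite ipC ip0l. Qed.
Lemma ipxx x : ip x x = nm x ^+ 2.
Proof.
by rewrite /ip inner_norm norm_nm expr2 -of_realM real_part_of_real.
Qed.
Lemma nm_ge0 x : 0 <= nm x.
Proof. by rewrite -(of_real_le k) -norm_nm of_real0. Qed.
Lemma nm0_eq0 x : nm x = 0 -> x = 0.
Proof. by move=> x0; apply/eqP; rewrite -normr_eq0 norm_nm x0 of_real0. Qed.
Lemma nm0 : nm 0 = 0.
Proof. by rewrite /nm normr0 -(of_real0 R k) real_part_of_real. Qed.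
Lemma nmD x y : nm (x + y) <= nm x + nm y.
Proof. by rewrite -(of_real_le k) of_realD -!norm_nm ler_normD. Qed.
Lemma nmN x : nm (- x) = nm x.
Proof. by rewrite /nm normrN. Qed.
Lemma nmB x y : nm (x - y) <= nm x + nm y.
Proof. by rewrite -(nmN y) nmD. Qed.
Lemma nm_distC x y : nm (x - y) = nm (y - x).
Proof. by rewrite /nm distrC. Qed.
Lemma nmZ a x : nm (rscale a x) = `|a| * nm x.
Proof.
apply/eqP; rewrite -(@eqrXn2 _ 2%N) ?mulr_ge0 ?nm_ge0 //.
by rewrite exprMn -!ipxx ipZl ipZr mulrA -expr2 real_normK ?num_real.
Qed.
Lemma ipxx_ge0 x : 0 <= ip x x.
Proof. by rewrite ipxx sqr_ge0. Qed.

Definition ipE := (ipDl, ipDr, ipZl, ipZr, ipNl, ipNr).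

Lemma cauchy_schwarz_sqr x y : ip x y ^+ 2 <= ip x x * ip y y.
Proof.
have [y0|y0] := eqVneq (nm y) 0.
  by rewrite (nm0_eq0 y0) !ip0r mulr0 expr0n.
have yp : 0 < ip y y by rewrite ipxx exprn_gt0 // lt_def y0 nm_ge0.
have := ipxx_ge0 (rscale (ip y y) x - rscale (ip x y) y).
rewrite !ipE (ipC y x) => h.
have {}h : 0 <= ip y y * (ip x x * ip y y - ip x y ^+ 2) by nra.
by rewrite pmulr_rge0 // in h; lra.
Qed.

Lemma cauchy_schwarz x y : `|ip x y| <= nm x * nm y.
Proof.
rewrite -(@ler_pXn2r _ 2%N) // ?nnegrE ?mulr_ge0 ?nm_ge0 //.
by rewrite real_normK ?num_real // exprMn -!ipxx cauchy_schwarz_sqr.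
Qed.

Lemma nm_le_sqr x b : 0 <= b -> (nm x <= b) = (ip x x <= b ^+ 2).
Proof. by move=> b0; rewrite ipxx ler_pXn2r // nnegrE nm_ge0. Qed.

Lemma rscaleDr a x y : rscale a (x + y) = rscale a x + rscale a y.
Proof. exact: scalerDr. Qed.
Lemma rscaleDl a b x : rscale (a + b) x = rscale a x + rscale b x.
Proof. by rewrite /rscale of_realD scalerDl. Qed.
Lemma rscaleA a b x : rscale a (rscale b x) = rscale (a * b) x.
Proof. by rewrite /rscale of_realM scalerA. Qed.
Lemma rscale1 x : rscale 1 x = x.
Proof. by rewrite /rscale of_real1 scale1r. Qed.
Lemma rscale0 x : rscale 0 x = 0.
Proof. by rewrite /rscale of_real0 scale0r. Qed.

(** Completeness phrased with real tolerances: the balls of the complex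
normed structure have complex radii. *)
Lemma nm_complete (u : nat -> V) :
  (forall e, 0 < e -> exists N, forall m n, (N <= m)%N -> (N <= n)%N ->
     nm (u m - u n) <= e) ->
  exists l, forall e, 0 < e -> exists N, forall n, (N <= n)%N -> nm (u n - l) <= e.
Proof.
move=> cu.
have scal_pos (e : scalars R k) : 0 < e ->
    0 < real_part e /\ e = of_real k (real_part e).
  move=> e0; have eE := ge0_real_part (ltW e0).
  by split => //; rewrite -(of_real_lt k) -eE of_real0.
have : cvg (u @ \oo).
  apply/cauchy_cvgP; apply: cauchy_exP => e /scal_pos[e0 eE].
  have [N hN] := cu _ (divr_gt0 e0 (ltr0n R 2)).
  exists (u N); exists N => //= n /= Nn.
  rewrite -ball_normE /= norm_nm eE of_real_lt.
  by apply: le_lt_trans (hN _ _ (leqnn N) Nn) _; lra.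
move=> /cvg_ex[l /cvgrPdist_le ul]; exists l => e e0.
have /ul [N _ hN] : 0 < of_real k e by rewrite -(of_real0 R k) of_real_lt.
by exists N => n /hN /=; rewrite norm_nm of_real_le nm_distC.
Qed.

End RealInner.

(** The real part of the inner product determines it: its imaginary part is
seen after multiplying the first argument by i. *)
Lemma inner_eq (R : realType) (k : scalar_kind) (V W : hilbertType R k)
    (x y : V) (x' y' : W) :
  ip x y = ip x' y' -> ip (imag R k *: x) y = ip (imag R k *: x') y' ->
  inner V x y = inner W x' y'.
Proof.
move=> h; rewrite /ip !linearZl_LR => h'.
exact: real_part_eq.
Qed.

(** * Limits, small perturbations of the identity, square roots *)
Lemma seq_cvg_unique (F : numFieldType) (V : pseudoMetricNormedZmodType F)
    (u : nat -> V) (l l' : V) : u @ \oo --> l -> u @ \oo --> l' -> l = l'.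
Proof. exact: norm_cvg_unique. Qed.

Section Limits.
Context (R : realType) (k : scalar_kind) (V : hilbertType R k).
Implicit Types (x y : V) (u : nat -> V) (b c e : R).

Lemma cvg_nmP u (l : V) : u @ \oo --> l <->
  forall e, 0 < e -> exists N, forall n, (N <= n)%N -> nm (u n - l) <= e.
Proof.
split=> [/cvgrPdist_le ul e e0|ul].
  have /ul [N _ hN] : 0 < of_real k e by rewrite -(of_real0 R k) of_real_lt.
  by exists N => n /hN /=; rewrite norm_nm of_real_le nm_distC.
apply/cvgrPdist_le => e e0; have eE := ge0_real_part (ltW e0).
have [|N hN] := ul (real_part e); first by rewrite -(of_real_lt k) -eE of_real0.
exists N => //= n /hN; rewrite norm_nm eE of_real_le.
by rewrite real_part_of_real nm_distC.
Qed.

Lemma cvg_ip u (l y : V) : u @ \oo --> l -> ip (u n) y @[n --> \oo] --> ip l y.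
Proof.
move=> /cvg_nmP ul; apply/cvgrPdist_le => e e0.
have yp : 0 < nm y + 1 by rewrite ltr_wpDl ?nm_ge0.
have [N hN] := ul _ (divr_gt0 e0 yp).
exists N => //= n /hN; rewrite ler_pdivlMr // => h.
rewrite distrC -ipNl -ipDl; apply: le_trans (cauchy_schwarz _ _) _.
have := nm_ge0 (u n - l); have := nm_ge0 y; nra.
Qed.

Lemma cvg_nm_le u (l : V) b : u @ \oo --> l -> (forall n, nm (u n) <= b) -> nm l <= b.
Proof.
move=> /cvg_nmP ul ub; apply/ler_addgt0Pr => e /ul[N /(_ _ (leqnn N)) h].
rewrite -(subrK (u N) l); apply: le_trans (nmD _ _) _.
by rewrite nm_distC addrC lerD.
Qed.

Lemma pow_small b c e : 0 <= b -> 0 <= c < 1 -> 0 < e ->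
  exists N, forall n, (N <= n)%N -> b * c ^+ n <= e.
Proof.
move=> b0 /andP[c0 c1] e0.
have bp : 0 < b + 1 by rewrite ltr_wpDl.
have /cvgrPdist_le /(_ _ (divr_gt0 e0 bp)) [N _ hN] : GRing.exp c @ \oo --> 0.
  by apply: cvg_expr; rewrite ger0_norm.
exists N => n /hN /=; rewrite sub0r normrN ger0_norm ?exprn_ge0 // ler_pdivlMr //.
by have := exprn_ge0 n c0; nra.
Qed.

Lemma geometric_limit u b c : 0 <= b -> 0 <= c < 1 ->
  (forall n, nm (u n.+1 - u n) <= b * c ^+ n) ->
  exists l : V, forall n, nm (u n - l) <= b / (1 - c) * c ^+ n.
Proof.
move=> b0 c01 ub; have /andP[c0 c1] := c01; have c1' : 0 < 1 - c by lra.
have step n j : nm (u (n + j)%N - u n) <= b / (1 - c) * c ^+ n.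
  suff : nm (u (n + j)%N - u n) <= b / (1 - c) * (c ^+ n - c ^+ (n + j)).
    move/le_trans; apply; apply: ler_wpM2l; first by rewrite divr_ge0 // ltW.
    by rewrite lerBlDr lerDl exprn_ge0.
  elim: j => [|j IH]; first by rewrite addn0 !subrr mulr0 nm0.
  rewrite addnS -(subrK (u (n + j)%N) (u _.+1)) -addrA.
  apply: le_trans (nmD _ _) _; apply: le_trans (lerD (ub _) IH) _.
  rewrite exprS le_eqVlt; apply/orP; left; apply/eqP; field.
  by rewrite gt_eqF.
have [|l lP] := @nm_complete _ _ _ u.
  move=> e e0.
  have [|N hN] := @pow_small (b / (1 - c) * 2) _ _ _ c01 e0.
    by rewrite !mulr_ge0 ?invr_ge0 // ltW.
  exists N => m n Nm Nn.
  rewrite -(subrK (u N) (u m)) -addrA; apply: le_trans (nmD _ _) _.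
  apply: le_trans (hN _ (leqnn N)); rewrite (nm_distC (u N)).
  have := step N (m - N)%N; have := step N (n - N)%N; rewrite !subnKC //; lra.
exists l => n; rewrite nm_distC.
apply: (@cvg_nm_le (fun j => u (n + j)%N - u n)); last exact: step.
apply: cvgB; last exact: cvg_cst.
by move/cvg_nmP: lP; rewrite -(cvg_shiftn n); under eq_fun do rewrite addnC.
Qed.

Lemma geometric_cvg u b c (l : V) : 0 <= b -> 0 <= c < 1 ->
  (forall n, nm (u n - l) <= b * c ^+ n) -> u @ \oo --> l.
Proof.
move=> b0 c01 ul; apply/cvg_nmP => e e0.
by have [N hN] := pow_small b0 c01 e0; exists N => n /hN; apply: le_trans.
Qed.

End Limits.

Section Operators.
Context (R : realType) (k : scalar_kind).
Implicit Types V W : hilbertType R k.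

Section LinearProp.
Context (V W : hilbertType R k) (f : V -> W) (lf : linear f).
Lemma lin0 : f 0 = 0.
Proof. by have := lf (-1) 0 0; rewrite scaler0 addr0 scaleN1r addNr. Qed.
Lemma linZ a x : f (a *: x) = a *: f x.
Proof. by rewrite -[a *: x]addr0 lf lin0 addr0. Qed.
Lemma linD x y : f (x + y) = f x + f y.
Proof. by rewrite -[x]scale1r lf !scale1r. Qed.
Lemma linN x : f (- x) = - f x.
Proof. by rewrite -scaleN1r linZ scaleN1r. Qed.
Lemma linB x y : f (x - y) = f x - f y.
Proof. by rewrite linD linN. Qed.
Lemma linR a x : f (rscale a x) = rscale a (f x).
Proof. exact: linZ. Qed.
End LinearProp.

Lemma cvg_linear V W (F : nat -> V -> W) (f : V -> W) :
  (forall n, linear (F n)) -> (forall x, F n x @[n --> \oo] --> f x) -> linear f.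
Proof.
move=> lF Ff a x y.
apply: (@seq_cvg_unique _ _ (fun n => F n (a *: x + y))) => //.
under eq_fun do rewrite lF.
by apply: cvgD => //; apply: cvgZl_tmp.
Qed.

Section Perturbation.
Context (V : hilbertType R k) (X : V -> V) (c : R).
Context (c01 : 0 <= c < 1) (lX : linear X) (Xc : forall x, nm (X x) <= c * nm x).

Lemma one_sub_inj x y : x - X x = y - X y -> x = y.
Proof.
have /andP[c0 c1] := c01 => h.
have {}h : x - y = X (x - y).
  have hx : x = y - X y + X x by rewrite -h subrK.
  by rewrite (linD lX) (linN lX) {1}hx addrAC [y - _]addrC addrK addrC.
apply/eqP; rewrite -subr_eq0; apply/eqP/nm0_eq0.
have := Xc (x - y); rewrite -h; have := nm_ge0 (x - y); nra.
Qed.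

(** The Neumann series, summed as the orbit of 0 under x |-> y + X x. *)
Lemma one_sub_surj y : exists x, x - X x = y.
Proof.
have /andP[c0 c1] := c01.
pose u n := iter n (fun x => y + X x) 0.
have uS n : u n.+1 = y + X (u n) by [].
have [||l ul] := @geometric_limit _ _ _ u (nm y) c _ c01; first exact: nm_ge0.
  elim=> [|n IH].
    by rewrite uS /= (lin0 lX) addr0 subr0 expr0 mulr1.
  rewrite (uS n.+1) [X in _ - X]uS opprD addrACA subrr add0r -(linB lX).
  apply: le_trans (Xc _) _; rewrite exprS mulrCA.
  exact: ler_wpM2l.
have cu : u @ \oo --> l.
  by apply: geometric_cvg ul => //; rewrite divr_ge0 ?nm_ge0 // subr_ge0 ltW.
exists l; apply/eqP; rewrite subr_eq; apply/eqP.
apply: (@seq_cvg_unique _ _ (fun n => u n.+1)).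
  by rewrite cvg_shiftS.
apply: cvgD; first exact: cvg_cst.
apply/cvg_nmP => e e0; move/cvg_nmP : cu => /(_ _ e0)[N hN].
exists N => n /hN h; rewrite -(linB lX); apply: le_trans (Xc _) _.
by have := nm_ge0 (u n - l); nra.
Qed.

End Perturbation.

(** S = 1 - Y is a square root of 1 - X when Y = (X + Y^2) / 2. On the operators
of norm at most a, the right-hand side is a contraction of ratio a, so the
iterates started at 0 converge geometrically; they stay linear, self-adjoint
and of norm at most a < 1, which makes S positive. *)
Lemma exists_opsqrt V (X : V -> V) (a : R) : 0 <= a < 1 -> linear X ->
  (forall x, nm (X x) <= a ^+ 2 * nm x) ->
  (forall x y, ip (X x) y = ip x (X y)) ->
  exists S : V -> V, positive_operator S /\ S \o S = idfun \- X.
Proof.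
move=> a01 lX Xa aX; have /andP[a0 a1] := a01.
pose F (Y : V -> V) (u : V) := rscale 2^-1 (X u + Y (Y u)).
pose Y n := iter n F (fun=> 0).
have lY n : linear (Y n).
  elim: n => [|n IH] b x y; first by rewrite /= scaler0 addr0.
  rewrite /= /F lX !IH /rscale scalerA mulrC -scalerA -scalerDr.
  by congr (_ *: _); rewrite scalerDr addrACA.
have half_nm x : nm (rscale 2^-1 x) = nm x / 2.
  by rewrite nmZ ger0_norm ?invr_ge0 // mulrC.
have Ya n u : nm (Y n u) <= a * nm u.
  elim: n u => [|n IH] u; first by rewrite nm0 mulr_ge0 ?nm_ge0.
  rewrite /= /F half_nm ler_pdivrMr //; apply: le_trans (nmD _ _) _.
  have h1 := Xa u; have h2 := IH (Y n u).
  have h3 : a * nm (Y n u) <= a * (a * nm u) by rewrite ler_wpM2l.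
  have h4 : a * (a * nm u) <= 1 * (a * nm u).
    by rewrite ler_wpM2r ?(ltW a1) ?mulr_ge0 ?nm_ge0.
  by rewrite expr2 -mulrA in h1; lra.
have aY n x y : ip (Y n x) y = ip x (Y n y).
  elim: n x y => [|n IH] x y; first by rewrite ip0l ip0r.
  by rewrite /= /F !ipE aX !IH.
have YS n u : nm (Y n.+1 u - Y n u) <= nm u * a ^+ n.
  elim: n u => [|n IH] u.
    rewrite /= /F addr0 subr0 half_nm ler_pdivrMr // expr0.
    have h : a ^+ 2 * nm u <= 1 * nm u.
      by rewrite ler_wpM2r ?nm_ge0 // exprn_ile1 // ltW.
    have := Xa u; have := nm_ge0 u; lra.
  rewrite (_ : _ - _ = rscale 2^-1 (Y n.+1 (Y n.+1 u) - Y n (Y n u))); last first.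
    by rewrite {1}/Y /= -/(Y n) {1}/F [in LHS]/F {1}/Y /= -/(Y n) /rscale
      -scalerBr opprD addrACA subrr add0r.
  rewrite half_nm ler_pdivrMr //.
  rewrite (_ : _ - _ = Y n.+1 (Y n.+1 u - Y n u) + (Y n.+1 (Y n u) - Y n (Y n u)));
    last by rewrite (linB (lY n.+1)) addrA subrK.
  apply: le_trans (nmD _ _) _.
  have h1 := Ya n.+1 (Y n.+1 u - Y n u); have h2 := IH (Y n u).
  have h3 : a * nm (Y n.+1 u - Y n u) <= a * (nm u * a ^+ n) by rewrite ler_wpM2l.
  have h4 : nm (Y n u) * a ^+ n <= a * nm u * a ^+ n.
    by rewrite ler_wpM2r ?exprn_ge0.
  by rewrite exprS; lra.
have /choice[L YL] u : exists l, forall n, nm (Y n u - l) <= nm u / (1 - a) * a ^+ n.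
  by apply: geometric_limit => //; apply: nm_ge0.
have cY u : Y n u @[n --> \oo] --> L u.
  apply: geometric_cvg (YL u) => //.
  by rewrite divr_ge0 ?nm_ge0 // subr_ge0 ltW.
have lL : linear L by exact: cvg_linear cY.
have La u : nm (L u) <= a * nm u by apply: cvg_nm_le (cY u) _.
have aL x y : ip (L x) y = ip x (L y).
  apply: (@seq_cvg_unique _ _ (fun n => ip (Y n x) y)).
    exact: cvg_ip.
  under eq_fun do rewrite aY ipC.
  by rewrite ipC; apply: cvg_ip.
have LE u : rscale 2^-1 (X u + L (L u)) = L u.
  apply: (@seq_cvg_unique _ _ (fun n => Y n.+1 u)).
    apply: cvgZl_tmp; apply: cvgD; first exact: cvg_cst.
    suff h : Y n (Y n u) - Y n (L u) @[n --> \oo] --> (0 : V).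
      rewrite -[L (L u)]add0r.
      rewrite (_ : (fun n => Y n (Y n u)) =
        (fun n => Y n (Y n u) - Y n (L u)) \+ (fun n => Y n (L u))).
        exact: cvgD h (cY (L u)).
      by apply/funext => n /=; rewrite subrK.
    apply/cvg_nmP => e e0; move/cvg_nmP : (cY u) => /(_ _ e0)[N hN].
    exists N => n /hN h; rewrite subr0 -(linB (lY n)).
    by apply: le_trans (Ya _ _) _; have := nm_ge0 (Y n u - L u); nra.
  by rewrite (cvg_shiftS (fun n => Y n u)).
pose S u := u - L u.
have lS : linear S by move=> b x y; rewrite /S lL scalerBr opprD addrACA.
have aS x y : ip (S x) y = ip x (S y) by rewrite /S !ipE aL.
have aS' x y : inner V (S x) y = inner V x (S y).
  by apply: inner_eq; rewrite -?linZ // aS.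
exists S; split; last first.
  apply/funext => u; rewrite /= /S (linB lL).
  have : L u + L u = X u + L (L u).
    rewrite -[in LHS](LE u) -rscaleDl (_ : 2^-1 + 2^-1 = 1) ?rscale1 //; lra.
  move=> h; rewrite opprD addrA -[u - L u - L u]addrA -opprD h.
  by rewrite opprD addrA opprK addrNK.
split => // [|x].
- exists (of_real k (1 + a)) => x.
  rewrite !norm_nm -of_realM of_real_le; apply: le_trans (nmB _ _) _.
  by have := La x; lra.
- apply: conj_fix_ge0.
    by rewrite [in RHS]aS' [RHS]hermC expr0 mul1r.
  rewrite -/(ip _ _) /S !ipE ipxx.
  have := cauchy_schwarz (L x) x; have := La x; have := nm_ge0 x.
  by rewrite ler_norml => ? ? /andP[]; nra.
Qed.

End Operators.

(** * Adjoints from a frame of a finite-dimensional space *)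
Section Frames.
Context (R : realType) (k : scalar_kind) (V : hilbertType R k).
Implicit Types (x y e : V) (s : seq V).

(** For an orthonormal list [s] over the real numbers, this is the orthogonal
projection onto its real span. *)
Definition frame_sum s x : V := \sum_(e <- s) rscale (ip x e) e.

Lemma frame_sumD s x y : frame_sum s (x + y) = frame_sum s x + frame_sum s y.
Proof.
by rewrite /frame_sum -big_split; apply: eq_bigr => e _; rewrite ipDl rscaleDl.
Qed.

Lemma frame_sumZ s a x : frame_sum s (rscale a x) = rscale a (frame_sum s x).
Proof.
rewrite [RHS]scaler_sumr; apply: eq_bigr => e _.
by rewrite ipZl [RHS]rscaleA.
Qed.

Lemma ip_suml (I : Type) (r : seq I) (F : I -> V) x :
  ip (\sum_(i <- r) F i) x = \sum_(i <- r) ip (F i) x.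
Proof. by elim/big_ind2: _ => [|a b c d <- <-|//]; rewrite ?ip0l ?ipDl. Qed.

Lemma nm_sum_le (I : Type) (r : seq I) (F : I -> V) :
  nm (\sum_(i <- r) F i) <= \sum_(i <- r) nm (F i).
Proof.
elim/big_rec2: _ => [|i a b _ ab]; first by rewrite nm0.
by apply: le_trans (nmD _ _) _; rewrite lerD2l.
Qed.

Lemma ip_frame_sum s x y : ip (frame_sum s x) y = ip x (frame_sum s y).
Proof.
rewrite [RHS]ipC !ip_suml; apply: eq_bigr => e _.
by rewrite !ipZl (ipC e y) (ipC e x) mulrC.
Qed.

Lemma frame_sum_sum s (I : Type) (r : seq I) (F : I -> V) :
  frame_sum s (\sum_(i <- r) F i) = \sum_(i <- r) frame_sum s (F i).
Proof.
elim/big_ind2: _ => [|a b c d <- <-|//]; last by rewrite frame_sumD.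
by rewrite -(rscale0 0) frame_sumZ !rscale0.
Qed.

(** Gram-Schmidt, with orthonormality expressed as a reproducing property: being
linear in the vector, it passes from a list to its span. *)
Lemma gram_schmidt s : exists g : seq V,
  (forall e, e \in g -> frame_sum g e = e) /\
  (forall x, x \in s -> frame_sum g x = x).
Proof.
elim: s => [|x s [g [gg gs]]]; first by exists [::].
pose p := frame_sum g x; pose y := x - p.
have pp : frame_sum g p = p.
  rewrite {1}/p {2}/frame_sum frame_sum_sum; apply: eq_big_seq => e /gg eg.
  by rewrite frame_sumZ eg.
have py z : frame_sum g z = z -> ip z y = 0.
  by move=> zg; rewrite /y ipDr ipNr -ip_frame_sum zg subrr.
have [y0|y0] := eqVneq y 0.
  exists g; split=> // z; rewrite inE => /orP[/eqP->|/gs//].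
  by apply/esym/eqP; rewrite -subr_eq0; apply/eqP.
pose f := rscale (nm y)^-1 y.
have ny : nm y != 0 by apply: contra_neq y0; exact: nm0_eq0.
have ff : ip f f = 1.
  by rewrite /f ipZl ipZr ipxx; field.
have pf : frame_sum g f = 0.
  rewrite /f frame_sumZ /frame_sum big_seq big1 => [|e /gg eg].
    by rewrite /rscale scaler0.
  by rewrite ipC py ?rscale0.
have fz z : frame_sum g z = z -> frame_sum (f :: g) z = z.
  by move=> zg; rewrite /frame_sum big_cons /f ipZr py // mulr0 rscale0 add0r.
exists (f :: g); split=> z; rewrite inE => /orP[/eqP->|].
- by rewrite /frame_sum big_cons -/(frame_sum g f) pf addr0 ff rscale1.
- by move=> /gg; exact: fz.
- rewrite (_ : x = y + p); last by rewrite subrK.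
  rewrite frame_sumD (fz p) //; congr (_ + _).
  rewrite (_ : y = rscale (nm y) f); last by rewrite rscaleA divff ?rscale1.
  rewrite frame_sumZ /frame_sum big_cons -/(frame_sum g f) pf addr0 ff.
  by rewrite rscale1.
- by move=> /gs; exact: fz.
Qed.

(** Over the complex numbers the spanning family is doubled by its multiples
by i, since frames expand vectors with real coefficients. *)
Lemma exists_frame : finite_dimensional V ->
  exists g : seq V, forall x, frame_sum g x = x.
Proof.
move=> [n [e eV]].
have [g [_ gP]] := gram_schmidt
  ([seq e i | i <- enum 'I_n] ++ [seq imag R k *: e i | i <- enum 'I_n]).
exists g => x; have [c ->] := eV x.
rewrite frame_sum_sum; apply: eq_bigr => i _.
rewrite (scalar_decomp (c i)) scalerDl -scalerA.
rewrite frame_sumD !frame_sumZ !gP // mem_cat; apply/orP; [right|left].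
  by apply/mapP; exists i; rewrite ?mem_enum.
by apply/mapP; exists i; rewrite ?mem_enum.
Qed.

End Frames.

Section Adjoints.
Context (R : realType) (k : scalar_kind) (K H : hilbertType R k).
Context (K_findim : finite_dimensional K).

Lemma inner_adjoint (f : K -> H) : linear f ->
  forall x y, inner H (f x) y = inner K x (adjoint f y).
Proof.
move=> lf x y; rewrite /adjoint; case: xgetP => [z _ /(_ x)//|].
have [g gP] := exists_frame K_findim.
pose z := \sum_(e <- g) rscale (ip (f e) y) e.
have ipz x' : ip (f x') y = ip x' z.
  rewrite -(gP x') ipC [RHS]ipC /frame_sum.
  have -> (r : seq K) : f (\sum_(e <- r) rscale (ip x' e) e) =
      \sum_(e <- r) rscale (ip x' e) (f e).
    by elim/big_ind2: _ => [|a b c d <- <-|e _];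
      rewrite ?(lin0 lf) ?(linD lf) ?(linR lf).
  rewrite ipC ip_suml -/(frame_sum g x') gP ip_suml.
  by apply: eq_bigr => e _; rewrite !ipZl (ipC e) mulrC.
move=> /(_ z) []; move=> x'; apply: inner_eq => //.
by rewrite -(linZ lf) ipz.
Qed.

Section Adjoint.
Context (f : K -> H) (lf : linear f).

Lemma ip_adjoint x y : ip (f x) y = ip x (adjoint f y).
Proof. by rewrite /ip inner_adjoint. Qed.

Lemma ip_adjointr x y : ip (adjoint f y) x = ip y (f x).
Proof. by rewrite ipC -ip_adjoint ipC. Qed.

Lemma adjoint_linear : linear (adjoint f).
Proof.
move=> c x y; apply/eqP; rewrite -subr_eq0; apply/eqP/nm0_eq0.
set z := _ - _; apply/eqP; rewrite -sqrf_eq0 -ipxx {2}/z ipDr ipNr /ip.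
rewrite -inner_adjoint // linearPr [X in _ - real_part X]linearPr /=.
by rewrite !inner_adjoint // subrr.
Qed.

Lemma nm_adjoint a : 0 <= a -> (forall x, nm (f x) <= a * nm x) ->
  forall y, nm (adjoint f y) <= a * nm y.
Proof.
move=> a0 fa y; have [->|z0] := eqVneq (nm (adjoint f y)) 0.
  by rewrite mulr_ge0 ?nm_ge0.
have zp : 0 < nm (adjoint f y) by rewrite lt_def z0 nm_ge0.
rewrite -(ler_pM2l zp) -expr2 -ipxx -ip_adjoint.
apply: le_trans (ler_norm _) _; apply: le_trans (cauchy_schwarz _ _) _.
by rewrite mulrA [_ * a]mulrC ler_wpM2r ?nm_ge0.
Qed.

End Adjoint.
End Adjoints.

(** * The norm of a Moebius transform *)
Section OperatorNorm.
Context (R : realType) (k : scalar_kind) (K H : hilbertType R k).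
Implicit Types (f : K -> H) (c : R).

Lemma opnorm_le f c : 0 <= c -> (forall x, nm (f x) <= c * nm x) -> opnorm f <= c.
Proof.
move=> c0 fc; apply: ge_sup.
  by exists (real_part `|f 0|); exists 0 => //=; rewrite normr0 ler01.
move=> _ [x /= x1 <-]; apply: le_trans (fc x) _.
rewrite -[leRHS]mulr1 ler_wpM2l // -(of_real_le k) of_real1.
by rewrite -norm_nm.
Qed.

Lemma opnorm_has_sup f : (exists c, forall x, nm (f x) <= c * nm x) ->
  has_sup [set real_part `|f x| | x in [set x : K | `|x| <= 1]].
Proof.
move=> [c fc]; split.
  by exists (real_part `|f 0|); exists 0 => //=; rewrite normr0 ler01.
exists `|c| => _ [z /= z1 <-]; apply: le_trans (fc z) _.
rewrite norm_nm -(of_real1 R k) of_real_le in z1.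
have := ler_norm c; have := nm_ge0 z; have := normr_ge0 c; nra.
Qed.

Lemma nm_le_opnorm f :
  (forall a x, f (rscale a x) = rscale a (f x)) ->
  (exists c, forall x, nm (f x) <= c * nm x) ->
  forall x, nm (f x) <= opnorm f * nm x.
Proof.
move=> fZ fb x; have [x0|x0] := eqVneq (nm x) 0.
  by have [c fc] := fb; apply: le_trans (fc x) _; rewrite x0 !mulr0.
have xp : 0 < nm x by rewrite lt_def x0 nm_ge0.
rewrite -ler_pdivrMr // mulrC.
have -> : (nm x)^-1 * nm (f x) = nm (f (rscale (nm x)^-1 x)).
  by rewrite fZ nmZ ger0_norm // invr_ge0 ltW.
apply: ub_le_sup; first by case: (opnorm_has_sup fb).
exists (rscale (nm x)^-1 x) => //=.
rewrite norm_nm nmZ ger0_norm ?invr_ge0 ?(ltW xp) // mulVf //.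
by rewrite of_real1.
Qed.

Lemma opnorm_ge0 f : (exists c, forall x, nm (f x) <= c * nm x) -> 0 <= opnorm f.
Proof.
move=> fb; have [c fc] := fb; apply: ub_le_sup; first by case: (opnorm_has_sup fb).
exists 0; first by rewrite /= normr0 ler01.
apply/eqP; rewrite eq_le -!/(nm _) nm_ge0 andbT.
by apply: le_trans (fc 0) _; rewrite nm0 mulr0.
Qed.

End OperatorNorm.

Lemma opinvK (R : realType) (k : scalar_kind) (V : hilbertType R k)
    (T : V -> V) y : (exists x, T x = y) -> T (opinv T y) = y.
Proof. by move=> [x xy]; apply: pinvK; rewrite inE; exists x. Qed.

Lemma opsqrtP (R : realType) (k : scalar_kind) (V : hilbertType R k)
    (T : V -> V) : (exists S, positive_operator S /\ S \o S = T) ->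
  positive_operator (opsqrt T) /\ opsqrt T \o opsqrt T = T.
Proof.
by apply: (@xgetPex _ _ [set S : V -> V | positive_operator S /\ S \o S = T]).
Qed.

Section Moebius.
Context (R : realType) (k : scalar_kind) (K H : hilbertType R k).
Context (K_findim : finite_dimensional K).
Context (f g : K -> H) (a b : R) (lf : linear f) (lg : linear g).
Context (a01 : 0 <= a < 1) (fa : forall x, nm (f x) <= a * nm x).
Context (b01 : 0 <= b < 1) (gb : forall x, nm (g x) <= b * nm x).

Let fs := adjoint f.
Let SK := opsqrt (idfun \- (fs \o f)).
Let SH := opsqrt (idfun \- (f \o fs)).

Let a0 : 0 <= a. Proof. by case/andP: a01. Qed.
Let fsa y : nm (fs y) <= a * nm y. Proof. exact: nm_adjoint. Qed.
Let lfs : linear fs. Proof. exact: adjoint_linear. Qed.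

Lemma moebius_sqrtK : positive_operator SK /\ SK \o SK = idfun \- (fs \o f).
Proof.
apply: opsqrtP; apply: (exists_opsqrt a01).
- by move=> c x y /=; rewrite lf lfs.
- by move=> x /=; apply: le_trans (fsa _) _; rewrite expr2 -mulrA ler_wpM2l.
- by move=> x y /=; rewrite ip_adjointr // ip_adjoint.
Qed.

Lemma moebius_sqrtH : positive_operator SH /\ SH \o SH = idfun \- (f \o fs).
Proof.
apply: opsqrtP; apply: (exists_opsqrt a01).
- by move=> c x y /=; rewrite lfs lf.
- by move=> x /=; apply: le_trans (fa _) _; rewrite expr2 -mulrA ler_wpM2l.
- by move=> x y /=; rewrite ip_adjoint // ip_adjointr.
Qed.

Let a2 : 0 <= a ^+ 2 < 1.
Proof. by case/andP: a01 => ? ?; rewrite exprn_ge0 //= exprn_ilt1. Qed.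
Let ab : 0 <= a * b < 1.
Proof. by case/andP: a01 => ? ?; case/andP: b01 => ? ?; rewrite mulr_ge0 //=; nra. Qed.

Let SKE x : SK (SK x) = x - fs (f x).
Proof. by have [_ /(congr1 (@^~ x))] := moebius_sqrtK. Qed.
Let SHE x : SH (SH x) = x - f (fs x).
Proof. by have [_ /(congr1 (@^~ x))] := moebius_sqrtH. Qed.
Let lSK : linear SK. Proof. by case: moebius_sqrtK => -[]. Qed.
Let lSH : linear SH. Proof. by case: moebius_sqrtH => -[]. Qed.
Let ip_SK x y : ip (SK x) y = ip x (SK y).
Proof. by case: moebius_sqrtK => -[_ _ h _] _; rewrite /ip h. Qed.
Let ip_SH x y : ip (SH x) y = ip x (SH y).
Proof. by case: moebius_sqrtH => -[_ _ h _] _; rewrite /ip h. Qed.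

Let lfsf : linear (fs \o f). Proof. by move=> c x y /=; rewrite lf lfs. Qed.
Let lffs : linear (f \o fs). Proof. by move=> c x y /=; rewrite lfs lf. Qed.
Let fsf_le x : nm ((fs \o f) x) <= a ^+ 2 * nm x.
Proof. by apply: le_trans (fsa _) _; rewrite expr2 -mulrA ler_wpM2l. Qed.
Let ffs_le x : nm ((f \o fs) x) <= a ^+ 2 * nm x.
Proof. by apply: le_trans (fa _) _; rewrite expr2 -mulrA ler_wpM2l. Qed.

Let SK_inj : injective SK.
Proof.
move=> x y /(congr1 SK); rewrite !SKE.
exact: (one_sub_inj a2 lfsf fsf_le).
Qed.
Let SH_inj : injective SH.
Proof.
move=> x y /(congr1 SH); rewrite !SHE.
exact: (one_sub_inj a2 lffs ffs_le).
Qed.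
Let SK_surj y : exists x, SK x = y.
Proof.
by have [x xy] := one_sub_surj a2 lfsf fsf_le y; exists (SK x); rewrite SKE.
Qed.
Let SH_surj y : exists x, SH x = y.
Proof.
by have [x xy] := one_sub_surj a2 lffs ffs_le y; exists (SH x); rewrite SHE.
Qed.

Let X x := - fs (g x).
Let lX : linear X.
Proof. by move=> c x y; rewrite /X lg lfs opprD scalerN. Qed.
Let X_le x : nm (X x) <= a * b * nm x.
Proof. by rewrite nmN; apply: le_trans (fsa _) _; rewrite -mulrA ler_wpM2l. Qed.
Let J_inj x y : x + fs (g x) = y + fs (g y) -> x = y.
Proof.
have h z : z + fs (g z) = z - X z by rewrite /X opprK.
by rewrite !h; apply: (one_sub_inj ab lX X_le).
Qed.
Let J_surj y : exists x, x + fs (g x) = y.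
Proof.
by have [x xy] := one_sub_surj ab lX X_le y; exists x; rewrite -xy /X opprK.
Qed.

(** The relation [graph u v m] characterises m = M(u) without inverses; the
vector v = (1 + f^* g)^-1 S_K u is the natural parameter. *)
Let graph u v m := v + fs (g v) = SK u /\ SH m = f v + g v.

Lemma moebius_graph u : exists v, graph u v (moebius f g u).
Proof.
exists (opinv (idfun \+ (fs \o g)) (SK u)); split.
  have : exists x, (idfun \+ (fs \o g)) x = SK u by exact: J_surj.
  by move=> /opinvK.
exact: (opinvK (SH_surj _)).
Qed.

Lemma graph_unique u v m v' m' : graph u v m -> graph u v' m' -> v = v' /\ m = m'.
Proof.
move=> [vu mv] [vu' mv']; have vv : v = v' by apply: J_inj; rewrite vu vu'.
by split => //; apply: SH_inj; rewrite mv mv' vv.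
Qed.

(** The identity 1 - M^* M = S_K (1 + g^* f)^-1 (1 - g^* g) (1 + f^* g)^-1 S_K,
tested at u. The proof solves (1 - f f^* ) y = (f + g) v; then z = v + f^* y
solves (1 - f^* f) z = v + f^* g v, and the two quadratic forms are <z, .> and
<y, .>. *)
Lemma graph_energy u v m : graph u v m ->
  ip u u - ip m m = ip v v - ip (g v) (g v).
Proof.
move=> [vu mv]; have [y ym] := SH_surj m.
have yE : y - f (fs y) = f v + g v by rewrite -SHE ym.
pose z := v + fs y.
have fz : f z = y - g v.
  by rewrite (linD lf); apply/eqP; rewrite eq_sym subr_eq addrAC -yE subrK.
have zu : u = SK z.
  apply: SK_inj; rewrite -vu SKE fz (linB lfs) /z.
  by rewrite opprD opprK addrA addrK.
have -> : ip u u = ip z (v + fs (g v)).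
  by rewrite vu [in LHS]zu ip_SK -zu.
have -> : ip m m = ip y (f v + g v) by rewrite -mv -[in LHS]ym ip_SH ym.
rewrite !ipDr -ip_adjoint // fz /z ipDl ip_adjointr // ipDl ipNl.
ring.
Qed.

Lemma graph_pairing u v m w : graph u v m ->
  ip v w + ip (g v) (f w) = ip u (SK w).
Proof. by move=> [vu _]; rewrite -ip_SK -vu ipDl ip_adjointr. Qed.

Lemma energy_sqrt w : ip (SK w) (SK w) = ip w w - ip (f w) (f w).
Proof. by rewrite ip_SK SKE ipDr ipNr -ip_adjoint. Qed.

Lemma moebius_rscale c u : moebius f g (rscale c u) = rscale c (moebius f g u).
Proof.
have [v [vu mv]] := moebius_graph u.
have [v' vm'] := moebius_graph (rscale c u).
suff h : graph (rscale c u) (rscale c v) (rscale c (moebius f g u)).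
  by have [_ ->] := graph_unique vm' h.
split.
  by rewrite (linR lg) (linR lfs) -rscaleDr vu (linR lSK).
by rewrite (linR lSH) mv (linR lg) (linR lf) rscaleDr.
Qed.

(** By [graph_energy] the bound says (1 - t^2) |u|^2 <= D_g(v). Since
|u|^2 is the supremum over w of <u, S_K w>^2 / |S_K w|^2, attained at S_K w = u,
and both factors have closed forms ([graph_pairing], [energy_sqrt]), the square
root S_K disappears. *)
Lemma moebius_le_iff t : 0 <= t <= 1 ->
  (forall u, nm (moebius f g u) <= t * nm u) <->
  (forall v w, (1 - t ^+ 2) * (ip v w + ip (g v) (f w)) ^+ 2 <=
    (ip v v - ip (g v) (g v)) * (ip w w - ip (f w) (f w))).
Proof.
move=> /andP[t0 t1]; have t2 : t ^+ 2 <= 1 by rewrite exprn_ile1.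
split => [Mt v w|cond u].
  have [u uv] := SK_surj (v + fs (g v)).
  have [v' gr] := moebius_graph u.
  have vv : v = v' by apply: J_inj; case: gr => -> _; rewrite uv.
  rewrite {}vv in uv *.
  rewrite -(graph_energy gr) (graph_pairing _ gr) -energy_sqrt.
  have h1 : ip (moebius f g u) (moebius f g u) <= t ^+ 2 * ip u u.
    by rewrite !ipxx -exprMn ler_pXn2r // ?nnegrE ?mulr_ge0 ?nm_ge0.
  apply: le_trans (_ : (1 - t ^+ 2) * (ip u u * ip (SK w) (SK w)) <= _).
    by rewrite ler_wpM2l ?subr_ge0 // cauchy_schwarz_sqr.
  by rewrite mulrA ler_wpM2r ?ipxx_ge0 //; lra.
have [v gr] := moebius_graph u.
have [w wu] := SK_surj u.
have := cond v w; rewrite -(graph_energy gr) (graph_pairing _ gr) -energy_sqrt wu.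
rewrite nm_le_sqr ?mulr_ge0 ?nm_ge0 // exprMn -[nm u ^+ 2]ipxx.
have := ipxx_ge0 u; rewrite le_eqVlt => /orP[/eqP u0 _|u0].
  have u00 : u = 0 by apply/nm0_eq0/eqP; rewrite -sqrf_eq0 -ipxx -u0.
  have v0 : v = 0.
    apply: J_inj; case: gr => -> _.
    by rewrite u00 (lin0 lSK) (lin0 lg) (lin0 lfs) addr0.
  by have := graph_energy gr; rewrite v0 (lin0 lg) !ip0l -u0 mulr0; lra.
by rewrite expr2 mulrA ler_pM2r //; lra.
Qed.

(** Some bound below 1 is needed before the operator norm, a supremum, can be
known to bound M. *)
Lemma moebius_crude_bound :
  exists2 t, 0 <= t < 1 & forall u, nm (moebius f g u) <= t * nm u.
Proof.
have /andP[_ a1] := a01; have /andP[b0 b1] := b01; have /andP[_ a21] := a2.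
have b2 : b ^+ 2 < 1 by rewrite exprn_ilt1.
(* The pairing is at most 2 |v| |w|, hence the factor 4. *)
pose q := (1 - a ^+ 2) * (1 - b ^+ 2) / 4.
have q0 : 0 < q by rewrite /q !mulr_gt0 ?subr_gt0.
have q1 : q <= 1.
  have : (1 - a ^+ 2) * (1 - b ^+ 2) <= 1 * 1.
    by apply: ler_pM; have := sqr_ge0 a; have := sqr_ge0 b; lra.
  rewrite /q; lra.
have sq : Num.sqrt (1 - q) ^+ 2 = 1 - q by rewrite sqr_sqrtr // subr_ge0.
exists (Num.sqrt (1 - q)).
  by rewrite sqrtr_ge0 /= -(@ltr_pXn2r _ 2) ?nnegrE ?sqrtr_ge0 // sq expr1n; lra.
apply/moebius_le_iff.
  by rewrite sqrtr_ge0 -(@ler_pXn2r _ 2) ?nnegrE ?sqrtr_ge0 // sq expr1n; lra.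
move=> v w; rewrite sq opprB addrCA subrr addr0.
have hg : ip (g v) (g v) <= b ^+ 2 * ip v v.
  by rewrite !ipxx -exprMn ler_pXn2r // ?nnegrE ?mulr_ge0 ?nm_ge0.
have hf : ip (f w) (f w) <= a ^+ 2 * ip w w.
  by rewrite !ipxx -exprMn ler_pXn2r // ?nnegrE ?mulr_ge0 ?nm_ge0.
have h : (ip v w + ip (g v) (f w)) ^+ 2 <= 4 * (ip v v * ip w w).
  have := cauchy_schwarz_sqr v w; have := cauchy_schwarz_sqr (g v) (f w).
  have h1 : ip (g v) (g v) * ip (f w) (f w) <= ip v v * ip w w.
    apply: ler_pM; rewrite ?ipxx_ge0 //.
      by have := ipxx_ge0 v; nra.
    by have := ipxx_ge0 w; nra.
  have := sqr_ge0 (ip v w - ip (g v) (f w)); nra.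
apply: le_trans (ler_wpM2l (ltW q0) h) _.
have -> : q * (4 * (ip v v * ip w w)) =
   ((1 - b ^+ 2) * ip v v) * ((1 - a ^+ 2) * ip w w) by rewrite /q; field.
apply: ler_pM; rewrite ?mulr_ge0 ?ipxx_ge0 ?subr_ge0 ?(ltW b2) ?(ltW a21) //; lra.
Qed.

Lemma moebius_opnorm_le t : 0 <= t <= 1 -> opnorm (moebius f g) <= t <->
  (forall v w, (1 - t ^+ 2) * (ip v w + ip (g v) (f w)) ^+ 2 <=
    (ip v v - ip (g v) (g v)) * (ip w w - ip (f w) (f w))).
Proof.
move=> t01; rewrite -moebius_le_iff //; have /andP[t0 _] := t01; split => [Mt u|].
  have [s s01 Ms] := moebius_crude_bound.
  apply: le_trans (nm_le_opnorm moebius_rscale _ u) _; first by exists s.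
  by rewrite ler_wpM2r ?nm_ge0.
exact: opnorm_le.
Qed.

Lemma moebius_opnorm_itv : 0 <= opnorm (moebius f g) < 1.
Proof.
have [s /andP[s0 s1] Ms] := moebius_crude_bound.
by rewrite opnorm_ge0 ?(le_lt_trans (opnorm_le s0 Ms)) //; exists s.
Qed.

End Moebius.

(** * The distance on the operator ball *)
Section UnitBall.
Context (R : realType) (k : scalar_kind) (K H : hilbertType R k).
Implicit Types (X Y Z N : unit_ball K H) (v w : K).

Lemma ball_linear X : linear X.
Proof. by move=> a x y; rewrite linearP. Qed.

Lemma ball_rscale X a v : X (rscale a v) = rscale a (X v).
Proof. exact: linR (ball_linear X) _ _. Qed.

Lemma ball_nm_bounded X : exists c, forall v, nm (X v) <= c * nm v.
Proof.
have [M XM] := ball_bounded X; exists (real_part M) => v.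
have := le_real_part (XM v).
rewrite !norm_nm real_part_of_real mulrC real_partM mulrC //.
Qed.

Lemma ball_nm_le X v : nm (X v) <= opnorm X * nm v.
Proof. exact: nm_le_opnorm (ball_rscale X) (ball_nm_bounded X) v. Qed.

Lemma ball_opnorm_itv X : 0 <= opnorm X < 1.
Proof. by rewrite ball_opnorm andbT opnorm_ge0 //; exact: ball_nm_bounded. Qed.

Lemma ball_ext X Y : (forall v, X v = Y v) -> X = Y.
Proof.
case: X Y => [[X [[Xs] [Xz]]] bX oX] [[Y [[Ys] [Yz]]] bY oY] /= /funext XY.
subst Y.
rewrite (Prop_irrelevance Xs Ys) in bX oX *.
rewrite (Prop_irrelevance Xz Yz) in bX oX *.
by congr UnitBall; exact: Prop_irrelevance.
Qed.

Lemma ball_of_linear (f : K -> H) r : linear f -> 0 <= r < 1 ->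
  (forall v, nm (f v) <= r * nm v) -> exists X, forall v, X v = f v.
Proof.
move=> lf /andP[r0 r1] fr.
pose F := HB.pack_for {linear K -> H} f (GRing.isLinear.Build _ _ _ _ f lf).
have bF : bounded_operator F.
  by exists (of_real k r) => v; rewrite !norm_nm -of_realM of_real_le.
have oF : opnorm F < 1 by apply: le_lt_trans r1; apply: opnorm_le.
by exists (UnitBall bF oF).
Qed.

Definition defect X v : R := ip v v - ip (X v) (X v).

Definition pairing X Y v w : R := ip v w - ip (X v) (Y w).

(** This is sinh^2 of the distance rho, since rho = artanh t gives
cosh^2 rho = 1 / (1 - t^2). *)
Definition sinhsq X Y : R := (1 - opnorm (moebius (\- X) Y) ^+ 2)^-1 - 1.

(** A quantitative form of being separated from the boundary: |X|^2 <= 1 - q. *)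
Definition gap (q : R) X : Prop := forall v, q * ip v v <= defect X v.

Lemma pairingC X Y v w : pairing X Y v w = pairing Y X w v.
Proof. by rewrite /pairing ipC (ipC (X v)). Qed.

Lemma ip_ball_le X v : ip (X v) (X v) <= ip v v.
Proof.
have /andP[r0 r1] := ball_opnorm_itv X.
rewrite !ipxx ler_pXn2r ?nnegrE ?nm_ge0 //.
by apply: le_trans (ball_nm_le X v) _; rewrite ler_piMl ?nm_ge0 ?(ltW r1).
Qed.

Lemma defect_ge0 X v : 0 <= defect X v.
Proof. by rewrite subr_ge0 ip_ball_le. Qed.

Lemma defect_le X v : defect X v <= ip v v.
Proof. by rewrite gerBl ipxx_ge0. Qed.

Lemma nm_ball_le X v : nm (X v) <= nm v.
Proof. by rewrite nm_le_sqr ?nm_ge0 // -ipxx ip_ball_le. Qed.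

Lemma gap_opnorm X r : 0 <= r -> opnorm X <= r -> gap (1 - r ^+ 2) X.
Proof.
move=> r0 Xr v; rewrite mulrBl mul1r lerB // !ipxx -exprMn.
rewrite ler_pXn2r ?nnegrE ?mulr_ge0 ?nm_ge0 //.
by apply: le_trans (ball_nm_le X v) _; rewrite ler_wpM2r ?nm_ge0.
Qed.

Lemma pairing_le X Y v w : `|pairing X Y v w| <= 2 * (nm v * nm w).
Proof.
rewrite /pairing; apply: le_trans (ler_normB _ _) _.
have h1 := cauchy_schwarz v w; have h2 := cauchy_schwarz (X v) (Y w).
have h3 : nm (X v) * nm (Y w) <= nm v * nm w.
  by rewrite ler_pM ?nm_ge0 ?nm_ball_le.
by lra.
Qed.

Section Distance.
Context (K_findim : finite_dimensional K).

Lemma moebius_ball_itv X Y : 0 <= opnorm (moebius (\- X) Y) < 1.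
Proof.
apply: (moebius_opnorm_itv K_findim _ (ball_linear Y) (ball_opnorm_itv X) _
  (ball_opnorm_itv Y) (ball_nm_le Y)).
- by move=> a x y; rewrite /= linearP opprD scalerN.
- by move=> v; rewrite /= nmN; exact: ball_nm_le.
Qed.

Lemma sinhsq_ge0 X Y : 0 <= sinhsq X Y.
Proof.
have /andP[t0 t1] := moebius_ball_itv X Y.
have : opnorm (moebius (\- X) Y) ^+ 2 < 1 by rewrite exprn_ilt1.
rewrite /sinhsq => t2; rewrite subr_ge0 invf_ge1 ?subr_gt0 //.
by rewrite gerBl exprn_ge0.
Qed.

Lemma sinhsq_le X Y s : 0 <= s -> sinhsq X Y <= s <->
  forall v w, pairing Y X v w ^+ 2 <= (1 + s) * (defect Y v * defect X w).
Proof.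
move=> s0; have s1 : 0 < 1 + s by lra.
have /andP[t0 t1] := moebius_ball_itv X Y.
set t := opnorm _ in t0 t1 *.
have t2 : t ^+ 2 < 1 by rewrite exprn_ilt1.
pose u := Num.sqrt (1 - (1 + s)^-1).
have i1 : (1 + s)^-1 <= 1 by rewrite invf_le1 //; lra.
have i0 : 0 < (1 + s)^-1 by rewrite invr_gt0.
have u2 : u ^+ 2 = 1 - (1 + s)^-1 by rewrite sqr_sqrtr // subr_ge0.
have u01 : 0 <= u <= 1.
  rewrite sqrtr_ge0 /= -(@ler_pXn2r _ 2) ?nnegrE ?sqrtr_ge0 // expr1n u2; lra.
have -> : sinhsq X Y <= s = (t <= u).
  rewrite /sinhsq -/t -(@ler_pXn2r _ 2 _ t) ?nnegrE ?sqrtr_ge0 // u2.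
  rewrite lerBlDl -[in LHS](invrK (1 + s)) lef_pV2 ?posrE ?subr_gt0 //.
  by apply/idP/idP; lra.
rewrite (moebius_opnorm_le K_findim _ (ball_linear Y) (ball_opnorm_itv X) _
  (ball_opnorm_itv Y) (ball_nm_le Y) u01).
- rewrite u2 opprB addrCA subrr addr0.
  by split=> h v w; have := h v w; rewrite /= !ipE opprK;
    rewrite -/(pairing Y X v w) -/(defect Y v) -/(defect X w) ler_pdivrMl.
- by move=> a x y; rewrite /= linearP opprD scalerN.
- by move=> v; rewrite /= nmN; exact: ball_nm_le.
Qed.

Lemma sinhsqP X Y v w :
  pairing Y X v w ^+ 2 <= (1 + sinhsq X Y) * (defect Y v * defect X w).
Proof. exact: (sinhsq_le X Y (sinhsq_ge0 X Y)).1 (lexx _) v w. Qed.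

Lemma sinhsqC X Y : sinhsq X Y = sinhsq Y X.
Proof.
have le A B : sinhsq A B <= sinhsq B A.
  apply: (sinhsq_le A B (sinhsq_ge0 B A)).2 => v w.
  by rewrite pairingC (mulrC (defect _ _)) sinhsqP.
by apply/eqP; rewrite eq_le !le.
Qed.

(** With s = 0 and w = v the inequality compares |v|^2 |Xv - Yv|^2 with a Gram
determinant, which is at most |Xv|^2 |Xv - Yv|^2; and |Xv| < |v|. *)
Lemma sinhsq_separated X Y : sinhsq X Y <= 0 -> X = Y.
Proof.
move=> /(sinhsq_le X Y (lexx 0)).1 h; apply: ball_ext => v.
apply/eqP; rewrite -subr_eq0; apply/eqP/nm0_eq0/eqP; rewrite -sqrf_eq0 -ipxx.
have [v0|v0] := eqVneq (nm v) 0.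
  by rewrite (nm0_eq0 v0) (lin0 (ball_linear X)) (lin0 (ball_linear Y)) subr0 ip0l.
have vp : 0 < nm v ^+ 2 by rewrite exprn_gt0 // lt_def v0 nm_ge0.
have := h v v; rewrite addr0 mul1r /pairing /defect => {}h.
set D := ip _ _; have D0 : 0 <= D by exact: ipxx_ge0.
have DE : D = ip (X v) (X v) + ip (Y v) (Y v) - 2 * ip (Y v) (X v).
  by rewrite /D !ipE (ipC (X v) (Y v)); ring.
have gram : ip (X v) (X v) * ip (Y v) (Y v) - ip (Y v) (X v) ^+ 2
    <= ip (X v) (X v) * D.
  have : 0 <= (ip (X v) (X v) - ip (Y v) (X v)) ^+ 2 by exact: sqr_ge0.
  by rewrite DE; nra.
have q : 0 < defect X v.
  have /andP[r0 r1] := ball_opnorm_itv X.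
  have := @gap_opnorm X _ r0 (lexx _) v; apply: lt_le_trans.
  by rewrite ipxx mulr_gt0 // subr_gt0 exprn_ilt1.
have : defect X v * D <= 0 by rewrite /defect; nra.
by rewrite pmulr_rle0 // => D0'; rewrite eq_le D0 D0'.
Qed.

Lemma rho_nonexpansive_sinhsq g X Y : rho_nonexpansive g ->
  sinhsq (g X) (g Y) <= sinhsq X Y.
Proof.
move=> /(_ X Y); rewrite /rho /sinhsq.
have /andP[t0 t1] := moebius_ball_itv X Y.
have /andP[s0 s1] := moebius_ball_itv (g X) (g Y).
set t := opnorm (moebius (\- X) Y) in t0 t1 *.
set s := opnorm (moebius (\- (g X)) (g Y)) in s0 s1 *.
rewrite /artanh ler_pM2r ?invr_gt0 // ler_ln ?posrE ?divr_gt0 //; try lra.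
rewrite ler_pdivrMr ?subr_gt0 // mulrAC ler_pdivlMr ?subr_gt0 // => st.
have {}st : s <= t by nra.
rewrite lerD2r lef_pV2 ?posrE ?subr_gt0 ?exprn_ilt1 // lerD2l lerN2.
by rewrite ler_pXn2r.
Qed.

End Distance.
End UnitBall.

(** * Convexity and compactness *)
Section Midpoints.
Context (R : realType) (k : scalar_kind) (K H : hilbertType R k).
Implicit Types (X Y Z N : unit_ball K H) (C : set (unit_ball K H)) (v w : K).

Definition is_mid N X Y : Prop := forall v, N v = rscale 2^-1 (X v + Y v).

Definition midconvex C : Prop :=
  forall X Y N, C X -> C Y -> is_mid N X Y -> C N.

Definition op_near (e : R) X Y : Prop := forall v, nm (X v - Y v) <= e * nm v.

Definition op_closed C : Prop :=
  forall Z, (forall e, 0 < e -> exists2 X, C X & op_near e X Z) -> C Z.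

Lemma midconvexI C C' : midconvex C -> midconvex C' -> midconvex (C `&` C').
Proof. by move=> c c' X Y N [? ?] [? ?] ?; split; [apply: (c X Y)|apply: (c' X Y)]. Qed.

Lemma exists_mid X Y : exists N, is_mid N X Y.
Proof.
have /andP[x0 x1] := ball_opnorm_itv X; have /andP[y0 y1] := ball_opnorm_itv Y.
pose f v := rscale 2^-1 (X v + Y v).
have [||v|N NE] := @ball_of_linear _ _ K H f ((opnorm X + opnorm Y) / 2).
- move=> a x y; rewrite /f !linearP /rscale scalerA mulrC -scalerA -scalerDr.
  by congr (_ *: _); rewrite scalerDr addrACA.
- by apply/andP; split; lra.
- rewrite nmZ ger0_norm ?invr_ge0 // mulrC -mulrA [_^-1 * _]mulrC mulrA.
  rewrite ler_pM2r ?invr_gt0 //; apply: le_trans (nmD _ _) _.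
  by rewrite mulrDl lerD ?ball_nm_le.
- by exists N.
Qed.

Lemma ip_mid N X Y v : is_mid N X Y -> ip (N v) (N v) =
  (ip (X v) (X v) + ip (Y v) (Y v)) / 2 - ip (X v - Y v) (X v - Y v) / 4.
Proof. by move=> ->; rewrite !ipE (ipC (Y v)); field. Qed.

Lemma defect_mid N X Y v : is_mid N X Y -> defect N v =
  (defect X v + defect Y v) / 2 + ip (X v - Y v) (X v - Y v) / 4.
Proof. by move=> m; rewrite /defect (ip_mid _ m); field. Qed.

Lemma pairing_mid N X Y Z v w : is_mid N X Y ->
  pairing N Z v w = (pairing X Z v w + pairing Y Z v w) / 2.
Proof. by move=> m; rewrite /pairing m !ipE; field. Qed.

Lemma op_nearC e X Y : op_near e X Y -> op_near e Y X.
Proof. by move=> h v; rewrite nm_distC. Qed.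

Lemma op_near_trans e e' X Y Z : op_near e X Y -> op_near e' Y Z ->
  op_near (e + e') X Z.
Proof.
move=> h h' v; rewrite -(subrK (Y v) (X v)) -addrA mulrDl.
by apply: le_trans (nmD _ _) _; rewrite lerD.
Qed.

Lemma defect_near e X Y v : 0 <= e -> nm (X v - Y v) <= e * nm v ->
  defect X v <= defect Y v + 2 * e * ip v v.
Proof.
move=> e0 XY.
have -> : defect X v = defect Y v - ip (X v - Y v) (X v + Y v).
  by rewrite /defect !ipE (ipC (Y v)); ring.
rewrite lerD2l; have := cauchy_schwarz (X v - Y v) (X v + Y v).
have h : nm (X v + Y v) <= 2 * nm v.
  have := nm_ball_le X v; have := nm_ball_le Y v; have := nmD (X v) (Y v); lra.
have : nm (X v - Y v) * nm (X v + Y v) <= e * nm v * (2 * nm v).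
  by rewrite ler_pM ?nm_ge0.
by rewrite ipxx ler_norml => ? /andP[]; lra.
Qed.

Lemma gap_closed q : op_closed (gap q).
Proof.
move=> Z Zq v; apply/ler_addgt0Pr => e e0.
have p : 0 < 2 * (ip v v + 1) by rewrite mulr_gt0 // ltr_wpDl ?ipxx_ge0.
have [X /(_ v) Xq XZ] := Zq _ (divr_gt0 e0 p).
apply: le_trans Xq _; apply: le_trans (defect_near _ (XZ v)) _.
  by rewrite divr_ge0 // ltW.
rewrite lerD2l mulrC mulrA [ip v v * 2]mulrC mulrA ler_pdivrMr //.
by have := ipxx_ge0 v; nra.
Qed.

Lemma pairing_near e X Y Z v w : 0 <= e -> nm (X v - Y v) <= e * nm v ->
  pairing X Z v w ^+ 2 <= pairing Y Z v w ^+ 2 + 4 * e * (ip v v * ip w w).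
Proof.
move=> e0 XY.
have h1 : `|pairing X Z v w - pairing Y Z v w| <= e * (nm v * nm w).
  have -> : pairing X Z v w - pairing Y Z v w = - ip (X v - Y v) (Z w).
    by rewrite /pairing !ipE; ring.
  rewrite normrN; apply: le_trans (cauchy_schwarz _ _) _.
  by rewrite mulrA ler_pM ?nm_ge0 ?nm_ball_le.
have h2 : `|pairing X Z v w + pairing Y Z v w| <= 4 * (nm v * nm w).
  apply: le_trans (ler_normD _ _) _.
  have := pairing_le X Z v w; have := pairing_le Y Z v w; lra.
have h := ler_pM (normr_ge0 _) (normr_ge0 _) h1 h2.
have := ler_norm ((pairing X Z v w - pairing Y Z v w) *
  (pairing X Z v w + pairing Y Z v w)).
rewrite normrM !ipxx; set A := pairing X Z v w; set B := pairing Y Z v w.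
rewrite -/A -/B in h *; nra.
Qed.

Section Distance.
Context (K_findim : finite_dimensional K).

(** The pairing is affine in X and the defect is concave. *)
Lemma sinhsq_ball_midconvex Z s : midconvex [set X | sinhsq Z X <= s].
Proof.
move=> X Y N /= ZX ZY m; have s0 : 0 <= s by apply: le_trans ZX; exact: sinhsq_ge0.
apply: (sinhsq_le K_findim Z N s0).2 => v w.
have := (sinhsq_le K_findim Z X s0).1 ZX v w.
have := (sinhsq_le K_findim Z Y s0).1 ZY v w.
rewrite (pairing_mid Z v w m) (defect_mid v m).
set A := pairing X Z v w; set B := pairing Y Z v w.
have : 0 <= (1 + s) * (ip (X v - Y v) (X v - Y v) * defect Z w).
  by rewrite !mulr_ge0 ?ipxx_ge0 ?defect_ge0 //; lra.
have := sqr_ge0 (A - B); set D := ip (X v - Y v) _; move=> *; nra.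
Qed.

(** Balls are separated from the boundary, uniformly for centres that are: in
the inequality at w = v, the pairing is at least (q / 2) |v|^2. *)
Lemma sinhsq_gap q c X Z : 0 < q -> 0 <= c -> gap q Z -> sinhsq Z X <= c ->
  gap (q ^+ 2 / (4 * (1 + c))) X.
Proof.
move=> q0 c0 gZ /(sinhsq_le K_findim Z X c0).1 h v.
have {}h := h v v.
have c1 : 0 < 4 * (1 + c) by lra.
rewrite mulrAC ler_pdivrMr //.
have [v0|v0] := eqVneq (ip v v) 0; first by rewrite v0 mulr0 mulr_ge0 ?defect_ge0 // ltW.
have vp : 0 < ip v v by rewrite lt_def v0 ipxx_ge0.
have p0 : q / 2 * ip v v <= pairing X Z v v.
  have := gZ v; have := defect_ge0 X v; rewrite /defect /pairing.
  have := ipxx_ge0 (X v - Z v); rewrite !ipE (ipC (Z v)); lra.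
have p2 : (q / 2 * ip v v) ^+ 2 <= pairing X Z v v ^+ 2.
  have q2 : 0 <= q / 2 * ip v v by rewrite mulr_ge0 ?divr_ge0 // ltW.
  by rewrite ler_pXn2r // nnegrE // (le_trans q2).
have p3 : (1 + c) * (defect X v * defect Z v) <= (1 + c) * (defect X v * ip v v).
  by rewrite ler_wpM2l ?ler_wpM2l ?defect_ge0 ?defect_le //; lra.
rewrite -(ler_pM2r vp); lra.
Qed.

Lemma gap_sinhsq q X Y : 0 < q -> gap q X -> gap q Y -> sinhsq X Y <= 4 / q ^+ 2.
Proof.
move=> q0 gX gY; have q2 : 0 < q ^+ 2 by rewrite exprn_gt0.
apply: (sinhsq_le K_findim X Y _).2 => [|v w]; first by rewrite divr_ge0 // ltW.
apply: le_trans (_ : 4 / q ^+ 2 * (defect Y v * defect X w) <= _); last first.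
  by rewrite ler_wpM2r ?mulr_ge0 ?defect_ge0 //; lra.
rewrite mulrAC ler_pdivlMr //.
have h : (q * ip v v) * (q * ip w w) <= defect Y v * defect X w.
  by rewrite ler_pM // mulr_ge0 ?ipxx_ge0 // ltW.
have : `|pairing Y X v w| ^+ 2 <= (2 * (nm v * nm w)) ^+ 2.
  by rewrite ler_pXn2r ?pairing_le // nnegrE ?mulr_ge0 ?nm_ge0.
rewrite real_normK ?num_real // !exprMn -!ipxx => p.
have := ler_wpM2r (ltW q2) p; lra.
Qed.

Lemma sinhsq_lipschitz q : 0 < q -> exists2 c, 0 < c & forall e X Y Z,
  0 <= e -> gap q X -> gap q Y -> gap q Z -> op_near e X Y ->
  sinhsq Z X <= sinhsq Z Y + c * e.
Proof.
move=> q0; have q2 : 0 < q ^+ 2 by rewrite exprn_gt0.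
pose S := 1 + 4 / q ^+ 2; have S0 : 0 < S by rewrite ltr_pwDl // divr_ge0 // ltW.
exists (2 * S / q + 4 / q ^+ 2).
  by rewrite addr_gt0 ?divr_gt0 ?mulr_gt0.
move=> e X Y Z e0 gX gY gZ XY.
have s0 := sinhsq_ge0 K_findim Z Y.
have sS : 1 + sinhsq Z Y <= S by rewrite lerD2l; exact: gap_sinhsq.
have c0 : 0 <= 2 * S / q + 4 / q ^+ 2.
  by rewrite addr_ge0 ?divr_ge0 ?mulr_ge0 // ltW.
apply: (sinhsq_le K_findim Z X _).2 => [|v w].
  by rewrite addr_ge0 // mulr_ge0.
apply: le_trans (pairing_near Z w e0 (XY v)) _.
have h1 := sinhsqP K_findim Z Y v w.
have h2 := defect_near e0 (op_nearC XY v).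
have DZ := defect_ge0 Z w; have v0 := ipxx_ge0 v; have w0 := ipxx_ge0 w.
have gv : ip v v <= defect X v / q by rewrite ler_pdivlMr // mulrC.
have gw : ip w w <= defect Z w / q by rewrite ler_pdivlMr // mulrC.
have h3 : (1 + sinhsq Z Y) * (defect Y v * defect Z w) <=
    (1 + sinhsq Z Y) * ((defect X v + 2 * e * ip v v) * defect Z w).
  by rewrite ler_wpM2l ?ler_wpM2r //; lra.
have h4 : (1 + sinhsq Z Y) * (2 * e * ip v v * defect Z w) <=
    S * (2 * e * (defect X v / q) * defect Z w).
  by apply: ler_pM => //; rewrite ?mulr_ge0 ?ler_wpM2r ?ler_wpM2l ?mulr_ge0 //; lra.
have h5 : 4 * e * (ip v v * ip w w) <= 4 * e * ((defect X v / q) * (defect Z w / q)).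
  by rewrite ler_wpM2l ?mulr_ge0 // ler_pM.
have -> : (1 + (sinhsq Z Y + (2 * S / q + 4 / q ^+ 2) * e)) * (defect X v * defect Z w)
  = (1 + sinhsq Z Y) * (defect X v * defect Z w)
    + S * (2 * e * (defect X v / q) * defect Z w)
    + 4 * e * ((defect X v / q) * (defect Z w / q)) by field; rewrite gt_eqF.
lra.
Qed.

End Distance.

Section ChainCompactness.
Context (K_findim : finite_dimensional K).

(** The minimal Hilbert-Schmidt norm increases along the chain to a bound M.
Almost minimal points of sets of the chain close to realising M are close to
each other by the parallelogram law, because of two such sets one contains
the other. *)
Lemma midconvex_chain_compact (q : R) (G : set (set (unit_ball K H))) :
  0 < q -> G !=set0 -> total_on G subset ->
  (forall C, G C -> [/\ C !=set0, midconvex C, op_closed C & C `<=` gap q]) ->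
  exists Z, forall C, G C -> C Z.
Proof.
move=> q0 [C0 GC0] Gtot GP.
have [g gP] := exists_frame K_findim.
pose hs X := \sum_(e <- g) ip (X e) (X e).
pose hsd X Y := \sum_(e <- g) ip (X e - Y e) (X e - Y e).
have hs_ge0 X : 0 <= hs X by apply: sumr_ge0 => e _; exact: ipxx_ge0.
have hs_le X : hs X <= \sum_(e <- g) ip e e by apply: ler_sum => e _; exact: ip_ball_le.
have hs_mid N X Y : is_mid N X Y -> hs N = (hs X + hs Y) / 2 - hsd X Y / 4.
  move=> m; rewrite /hs /hsd -big_split !mulr_suml -sumrB.
  by apply: eq_bigr => e _; rewrite (ip_mid _ m).
pose c := \sum_(e <- g) nm e.
have c0 : 0 <= c by apply: sumr_ge0 => e _; exact: nm_ge0.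
have hsd_near X Y r : 0 <= r -> hsd X Y <= r ^+ 2 -> op_near (c * r) X Y.
  move=> r0 XY v.
  have -> : X v - Y v = \sum_(e <- g) rscale (ip v e) (X e - Y e).
    have expand N : N v = \sum_(e <- g) rscale (ip v e) (N e).
      rewrite -[in LHS](gP v) linear_sum; apply: eq_bigr => e _.
      exact: ball_rscale.
    rewrite !expand -sumrB; apply: eq_bigr => e _.
    by rewrite /rscale scalerBr.
  apply: le_trans (nm_sum_le _ _) _.
  rewrite mulr_suml mulr_suml big_seq [leRHS]big_seq; apply: ler_sum => e eg.
  rewrite nmZ mulrAC; apply: ler_pM; rewrite ?nm_ge0 //.
    by rewrite mulrC cauchy_schwarz.
  rewrite nm_le_sqr //; apply: le_trans XY; rewrite /hsd (big_rem e eg) /=.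
  by rewrite lerDl sumr_ge0 // => e' _; exact: ipxx_ge0.
pose m C := inf (hs @` C).
have m_inf C : G C -> has_inf (hs @` C).
  move=> /GP[[X CX] _ _ _]; split; first by exists (hs X); exists X.
  by exists 0 => _ [Y _ <-].
have m_le C X : G C -> C X -> m C <= hs X.
  by move=> /m_inf[_ lb] CX; apply: ge_inf => //; exists X.
have supM : has_sup (m @` G).
  split; first by exists (m C0); exists C0.
  exists (\sum_(e <- g) ip e e) => _ [C GC <-].
  by have [[X CX] _ _ _] := GP _ GC; apply: le_trans (m_le _ _ GC CX) _.
pose M := sup (m @` G).
have m_M C : G C -> m C <= M.
  by move=> GC; apply: ub_le_sup; [case: supM|exists C].
(* The parallelogram law for the midpoint N of X and Y. *)
have close C X Y e : G C -> C X -> C Y -> M - e < m C ->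
    hs X <= M + e -> hs Y <= M + e -> hsd X Y <= 8 * e.
  move=> GC CX CY Ce Xe Ye; have [N Nm] := exists_mid X Y.
  have [_ cC _ _] := GP _ GC.
  have := m_le _ _ GC (cC _ _ _ CX CY Nm); rewrite (hs_mid _ _ _ Nm); lra.
(* The tolerance is a square because [hsd] is a squared distance. *)
pose e n : R := (2^-1 ^+ n) ^+ 2.
have e_gt0 n : 0 < e n by rewrite /e !exprn_gt0 // invr_gt0.
have /choice[D DP] n : exists C, G C /\ M - e n < m C.
  have [_ [C GC <-] h] := sup_adherent (e_gt0 n) supM.
  by exists C.
have pick C n : G C -> exists X, [/\ C X, D n X & hs X <= M + e n].
  move=> GC; have [GD _] := DP n.
  have [B GB [BC BD]] : exists2 B, G B & B `<=` C /\ B `<=` D n.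
    case: (Gtot _ _ GC GD) => h; [exists C|exists (D n)] => //;
      by split => //; exact: subset_refl.
  have [_ [X BX <-] h] := inf_adherent (e_gt0 n) (m_inf _ GB).
  exists X; split; [exact: BC|exact: BD|].
  by apply: le_trans (ltW h) _; rewrite lerD2r m_M.
have e_le n : e n.+1 <= e n.
  by have := e_gt0 n; rewrite /e (exprS _ n) exprMn; lra.
(* The factor 3 bounds the square root of 8. Summing the geometric series
   doubles it to 6 in near_Z, and a final detour through x n brings it to 9. *)
have near_pick n X Y : D n X -> D n Y -> hs X <= M + e n -> hs Y <= M + e n ->
    op_near (c * 3 * 2^-1 ^+ n) X Y.
  move=> DX DY Xe Ye; rewrite -mulrA; have [GD De] := DP n.
  apply: hsd_near; first by rewrite mulr_ge0 ?exprn_ge0 ?invr_ge0.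
  have := close _ _ _ _ GD DX DY De Xe Ye.
  by have := e_gt0 n; rewrite exprMn -/(e n); lra.
have /choice[x xP] n := pick _ n GC0.
have near_step n : op_near (c * 3 * 2^-1 ^+ n) (x n.+1) (x n).
  have [_ Dn xn] := xP n; have [_ DSn xSn] := xP n.+1.
  have [GD _] := DP n; have [GDS DSe] := DP n.+1.
  have xSn' : hs (x n.+1) <= M + e n by apply: le_trans xSn _; rewrite lerD2l.
  case: (Gtot _ _ GDS GD) => h; first by apply: near_pick => //; exact: h.
  rewrite -mulrA; apply: hsd_near; first by rewrite mulr_ge0 ?exprn_ge0 ?invr_ge0.
  have := close _ _ _ (e n) GDS DSn (h _ Dn) _ xSn' xn.
  have := e_gt0 n; rewrite exprMn -/(e n) => ? /(_ _) le8.
  by apply: le_trans (le8 _) _; have := e_le n; lra.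
have cx v : exists l, forall n, nm (x n v - l) <= c * 3 * nm v / (1 - 2^-1) * 2^-1 ^+ n.
  apply: (@geometric_limit _ _ _ (fun n => x n v)).
  - by rewrite !mulr_ge0 ?nm_ge0.
  - by rewrite invr_ge0 ler0n invf_lt1 // ltr1n.
  - by move=> n; rewrite mulrAC; exact: near_step.
have /choice[L LP] := cx.
have cvgL v : x n v @[n --> \oo] --> L v.
  apply: geometric_cvg (LP v); last by rewrite invr_ge0 ler0n invf_lt1 // ltr1n.
  by rewrite !mulr_ge0 ?nm_ge0 // invr_ge0; lra.
pose r := Num.sqrt (1 - Num.min q 1).
have q1 : 0 < Num.min q 1 <= 1 by rewrite lt_min q0 ltr01 ge_min lexx orbT.
have r2 : r ^+ 2 = 1 - Num.min q 1 by rewrite sqr_sqrtr // subr_ge0; case/andP: q1.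
have gapx n : gap q (x n) by have [C0x _ _] := xP n; have [_ _ _] := GP _ GC0; apply.
have [|||Z ZL] := @ball_of_linear _ _ K H L r.
- by apply: cvg_linear cvgL => n; exact: ball_linear.
- rewrite sqrtr_ge0 /= -(@ltr_pXn2r _ 2) ?nnegrE ?sqrtr_ge0 // r2 expr1n; lra.
- move=> v; apply: cvg_nm_le (cvgL v) _ => n.
  rewrite nm_le_sqr ?mulr_ge0 ?sqrtr_ge0 ?nm_ge0 // exprMn r2 -ipxx.
  have := gapx n v; rewrite /defect.
  have : Num.min q 1 * ip v v <= q * ip v v.
    by rewrite ler_wpM2r ?ipxx_ge0 // ge_min lexx.
  lra.
have near_Z n : op_near (c * 6 * 2^-1 ^+ n) (x n) Z.
  move=> v; rewrite ZL; apply: le_trans (LP v n) _.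
  rewrite (_ : 1 - 2^-1 = 2^-1); last by lra.
  by rewrite invrK; lra.
exists Z => C GC; have [_ _ clC _] := GP _ GC; apply: clC => d d0.
have [||n nP] := @pow_small _ (c * 9) 2^-1 d _ _ d0.
- by rewrite mulr_ge0.
- by rewrite invr_ge0 ler0n invf_lt1 // ltr1n.
have [X [CX DX Xn]] := pick _ n GC; exists X => // v.
have [_ Dn xn] := xP n.
have h : op_near (c * 9 * 2^-1 ^+ n) X Z.
  have -> : c * 9 * 2^-1 ^+ n = c * 3 * 2^-1 ^+ n + c * 6 * 2^-1 ^+ n by ring.
  by apply: op_near_trans (near_Z n); exact: near_pick.
by apply: le_trans (h v) _; rewrite ler_wpM2r ?nm_ge0 ?nP.
Qed.

End ChainCompactness.
End Midpoints.

(** * Normal structure *)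
Section TotalBoundedness.
Context (R : realType) (k : scalar_kind) (K : hilbertType R k).
Context (K_findim : finite_dimensional K).

(** Pigeonhole principle on the coordinates along a frame, rounded to
multiples of d. *)
Lemma unit_sphere_totally_bounded (v : nat -> K) (e : R) : 0 < e ->
  (forall n, nm (v n) <= 1) ->
  exists m n, (m < n)%N /\ nm (v m - v n) <= e.
Proof.
move=> e0 v1; have [g gP] := exists_frame K_findim.
pose c := \sum_(x <- g) nm x.
have c0 : 0 <= c by apply: sumr_ge0 => x _; exact: nm_ge0.
pose d := e / (c + 1).
have d0 : 0 < d by rewrite divr_gt0 // ltr_wpDl.
have coord n x : x \in g -> `|ip (v n) x| <= c.
  move=> xg; apply: le_trans (cauchy_schwarz _ _) _.
  apply: (@le_trans _ _ (nm x)); first by rewrite ler_piMl ?nm_ge0.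
  rewrite /c (big_rem x xg) /= lerDl sumr_ge0 // => y _; exact: nm_ge0.
pose cell n x := Num.truncn ((ip (v n) x + c) / d).
have cellP n x : x \in g ->
    (cell n x)%:R * d <= ip (v n) x + c < (cell n x)%:R * d + d.
  move=> /(coord n); rewrite ler_norml => /andP[h _].
  have : 0 <= (ip (v n) x + c) / d by rewrite divr_ge0 // ?(ltW d0) //; lra.
  move=> /truncn_itv; rewrite -/(cell n x) ler_pdivlMr // ltr_pdivrMr //.
  by rewrite -natr1 mulrDl mul1r.
pose N := Num.truncn (2 * c / d).
have cellN n x : x \in g -> (cell n x < N.+1)%N.
  move=> /(coord n); rewrite ler_norml ltnS => /andP[h1 h2].
  apply: le_truncn; rewrite ler_pM2r ?invr_gt0 //; lra.
pose T : finType := {ffun 'I_(size g) -> 'I_N.+1}.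
pose F (n : 'I_(#|T|.+1)) : T := [ffun j : 'I_(size g) => inord (cell n g`_j)].
have /injectivePn[m [n mn Fmn]] : ~~ injectiveb F.
  by apply/negP => /injectiveP /leq_card; rewrite card_ord ltnn.
have close : nm (v m - v n) <= e.
  rewrite -(gP (v m - v n)); apply: le_trans (nm_sum_le _ _) _.
  apply: (@le_trans _ _ (d * c)); last first.
    by rewrite /d mulrAC ler_pdivrMr ?ltr_wpDl // ler_pM2l // lerDl.
  rewrite mulr_sumr big_seq [leRHS]big_seq; apply: ler_sum => x xg.
  rewrite nmZ ler_wpM2r ?nm_ge0 //.
  have xi : (index x g < size g)%N by rewrite index_mem.
  have := congr1 (fun f : T => f (Ordinal xi)) Fmn.
  rewrite !ffunE /= nth_index // => /(congr1 val).
  rewrite /= !inordK ?cellN // => cc.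
  have /andP[a1 a2] := cellP m _ xg; have /andP[b1 b2] := cellP n _ xg.
  by rewrite cc in a1 a2; rewrite ipDl ipNl ler_norml; apply/andP; split; lra.
have [lt|le] := ltnP m n; first by exists m, n.
exists n, m; rewrite nm_distC; split=> //.
by rewrite ltn_neqAle le andbT eq_sym.
Qed.

End TotalBoundedness.

Section NormalStructure.
Context (R : realType) (k : scalar_kind) (K H : hilbertType R k).
Context (K_findim : finite_dimensional K).
Implicit Types (X Y Z A B : unit_ball K H) (v w : K).

Lemma pairing_cauchy_schwarz X v w : 0 < defect X w ->
  pairing X X v w ^+ 2 <= defect X v * defect X w.
Proof.
move=> w0; rewrite -subr_ge0 -(pmulr_rge0 _ w0).
have := defect_ge0 X (rscale (defect X w) v - rscale (pairing X X v w) w).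
rewrite {1}/defect (linB (ball_linear X)) !ball_rscale !ipE (ipC w v) (ipC (X w) (X v)).
rewrite /pairing /defect; lra.
Qed.

(** How far the inequality for sinh^2 rho(X,Y) <= r is from failing at (v,w). *)
Definition slack (r : R) X Y v w : R :=
  (1 + r) * (defect X v * defect Y w) - pairing X Y v w ^+ 2.

Lemma slack_mid r N X X' Y v w : is_mid N X X' ->
  slack r N Y v w = (slack r X Y v w + slack r X' Y v w) / 2
    + (1 + r) * (ip (X v - X' v) (X v - X' v) * defect Y w) / 4
    + (pairing X Y v w - pairing X' Y v w) ^+ 2 / 4.
Proof.
by move=> m; rewrite /slack (defect_mid v m) (pairing_mid Y v w m); field.
Qed.

Lemma slack_ge0 r X Y v w : sinhsq X Y <= r -> 0 <= slack r X Y v w.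
Proof.
move=> XY; rewrite subr_ge0; apply: (sinhsq_le K_findim Y X _).1.
  exact: le_trans (sinhsq_ge0 K_findim X Y) XY.
by rewrite sinhsqC.
Qed.

Lemma slack_small s X Y : 0 <= s -> s < sinhsq X Y ->
  exists v w, [/\ nm v = 1, nm w = 1 & slack s X Y v w <= 0].
Proof.
move=> s0 sXY; apply: contrapT => h.
suff : sinhsq Y X <= s by rewrite sinhsqC // leNgt sXY.
apply: (sinhsq_le K_findim Y X s0).2 => v w.
have [v0|v0] := eqVneq (nm v) 0.
  rewrite (nm0_eq0 v0) /pairing ip0l (lin0 (ball_linear X)) ip0l subr0 expr0n.
  by rewrite /= !mulr_ge0 ?defect_ge0 //; lra.
have [w0|w0] := eqVneq (nm w) 0.
  rewrite (nm0_eq0 w0) /pairing ip0r (lin0 (ball_linear Y)) ip0r subr0 expr0n.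
  by rewrite /= !mulr_ge0 ?defect_ge0 //; lra.
rewrite leNgt; apply/negP => lt; apply: h.
have unit (x : K) : nm x != 0 -> nm (rscale (nm x)^-1 x) = 1.
  by move=> x0; rewrite nmZ ger0_norm ?invr_ge0 ?nm_ge0 // mulVf.
exists (rscale (nm v)^-1 v), (rscale (nm w)^-1 w); split; rewrite ?unit //.
rewrite /slack /defect /pairing !ball_rscale !ipE.
set a := (nm v)^-1; set b := (nm w)^-1.
rewrite (_ : _ - _ = (a * b) ^+ 2 * slack s X Y v w); last first.
  by rewrite /slack /defect /pairing; ring.
by rewrite mulr_ge0_le0 ?sqr_ge0 // subr_le0 ltW.
Qed.

(** If Xv is close to Yv, then the pairing of X and Y at (v,w) is close to that
of Y with itself, for which the inequality holds with s = 0; this leaves a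
margin of about r D_Y(v) D_Y(w). *)
Lemma slack_lower q r e X Y v w : 0 < q -> 0 <= r -> 0 <= e ->
  gap q Y -> nm v = 1 -> nm w = 1 -> nm (X v - Y v) <= e ->
  r * q ^+ 2 - (6 + 2 * r) * e <= slack r X Y v w.
Proof.
move=> q0 r0 e0 gY v1 w1 XY.
have vv : ip v v = 1 by rewrite ipxx v1 expr1n.
have ww : ip w w = 1 by rewrite ipxx w1 expr1n.
have near : nm (X v - Y v) <= e * nm v by rewrite v1 mulr1.
have near' : nm (Y v - X v) <= e * nm v by rewrite nm_distC.
have := pairing_near Y w e0 near; have := defect_near e0 near'.
have := gY v; have := gY w; have := defect_le Y w.
rewrite vv ww !mulr1 => w2 gw gv dn pn.
have := @pairing_cauchy_schwarz Y v w (lt_le_trans q0 gw).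
rewrite /slack => cs.
have h1 : (1 + r) * ((defect Y v - 2 * e) * defect Y w) <=
    (1 + r) * (defect X v * defect Y w).
  by rewrite ler_wpM2l ?ler_wpM2r ?defect_ge0 //; lra.
have h2 : r * q ^+ 2 <= r * (defect Y v * defect Y w).
  by rewrite ler_wpM2l // expr2 ler_pM // ltW.
have h3 : (1 + r) * (2 * e) * defect Y w <= (1 + r) * (2 * e) * 1.
  by rewrite ler_wpM2l // !mulr_ge0 //; lra.
lra.
Qed.

(** The point X is the midpoint of A with the point found for the rest of the
list. By [slack_mid], concavity of the slack hands a small value at X down to A
and to that point, while the quadratic excess |Av - X'v|^2 is small as well. *)
Lemma iterated_midpoint (D : set (unit_ball K H)) (q r : R) :
  0 < q -> 0 < r -> D `<=` gap q -> midconvex D ->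
  (forall X Y, D X -> D Y -> sinhsq X Y <= r) ->
  forall (s : list (unit_ball K H)) A, D A ->
  (forall B, List.In B s -> D B) ->
  exists2 X, D X & forall e : R, 0 < e -> exists2 d : R, 0 < d &
    forall Y v w, D Y -> nm v = 1 -> nm w = 1 -> slack r X Y v w <= d ->
    forall B, List.In B (A :: s) -> slack r B Y v w <= e /\ nm (B v - X v) <= e.
Proof.
move=> q0 r0 gD cD rD; elim=> [|B s IH] A DA Ds.
  exists A => // e e0; exists e => // Y v w _ _ _ h B [<-|//].
  by split=> //; rewrite subrr nm0 ltW.
have [X' DX' X'P] := IH B (Ds B (or_introl erefl)) (fun C Cs => Ds C (or_intror Cs)).
have [N Nm] := exists_mid A X'.
exists N; first exact: cD DA DX' Nm.
move=> e e0; have [d' d'0 {}X'P] := X'P (e / 2) (divr_gt0 e0 (ltr0Sn _ 1)).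
(* The slack at A and at X' at most doubles, and |Av - X'v|^2 is at most
   4 / q times the slack at N. *)
exists (Num.min (d' / 2) (Num.min (e / 2) (q * e ^+ 2 / 16))).
  by rewrite !lt_min !divr_gt0 ?mulr_gt0 ?exprn_gt0.
move=> Y v w DY v1 w1; rewrite !le_min => /and3P[].
rewrite (slack_mid r Y v w Nm).
have sA := slack_ge0 v w (rD _ _ DA DY); have sX' := slack_ge0 v w (rD _ _ DX' DY).
have h1 : 0 <= (1 + r) * (ip (A v - X' v) (A v - X' v) * defect Y w).
  by rewrite !mulr_ge0 ?ipxx_ge0 ?defect_ge0 //; lra.
have h2 := sqr_ge0 (pairing A Y v w - pairing X' Y v w).
move=> d1 d2 d3.
have AX' : nm (A v - X' v) <= e / 2.
  rewrite nm_le_sqr ?divr_ge0 ?(ltW e0) //.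
  have := gD _ DY w; rewrite ipxx w1 expr1n mulr1 => gw.
  have p := ipxx_ge0 (A v - X' v).
  have h3 : 1 * (ip (A v - X' v) (A v - X' v) * q) <=
      (1 + r) * (ip (A v - X' v) (A v - X' v) * defect Y w).
    by apply: ler_pM; rewrite ?mulr_ge0 ?ler_wpM2l // ?(ltW q0) //; lra.
  rewrite -(ler_pM2r q0); lra.
have NA : nm (A v - N v) <= e / 4 /\ nm (X' v - N v) <= e / 4.
  have E : A v - N v = rscale 2^-1 (A v - X' v) /\
      X' v - N v = rscale 2^-1 (X' v - A v).
    have halves (x : H) : x = rscale 2^-1 x + rscale 2^-1 x.
      by rewrite -rscaleDl (_ : 2^-1 + 2^-1 = 1) ?rscale1 //; lra.
    rewrite Nm /rscale !scalerBr scalerDr; split.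
      by rewrite {1}(halves (A v)) /rscale opprD addrACA subrr add0r.
    by rewrite {1}(halves (X' v)) /rscale opprD [- _ - _]addrC addrACA subrr add0r.
  have e4 : 2^-1 * (e / 2) = e / 4 by field.
  by case: E => -> ->; rewrite !nmZ ger0_norm ?invr_ge0 // -e4 (nm_distC (X' v));
    split; rewrite ler_wpM2l // invr_ge0.
case: NA => NA NX'.
move=> C [<-|Cs]; first by split; lra.
have [||//||sC CX'] := X'P Y v w _ _ _ _ C Cs => //; first by lra.
split; first by lra.
rewrite -(subrK (X' v) (C v)) -addrA; apply: le_trans (nmD _ _) _; lra.
Qed.

Lemma diametral_witness (D : set (unit_ball K H)) (q r : R) :
  0 < q -> 0 < r -> D `<=` gap q -> midconvex D ->
  (forall X Y, D X -> D Y -> sinhsq X Y <= r) ->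
  (forall X (s : R), D X -> s < r -> exists2 Y, D Y & s < sinhsq X Y) ->
  forall A0, D A0 -> forall (e : R) (s : list (unit_ball K H)), 0 < e ->
  (forall B, List.In B s -> D B) ->
  exists Y v w, [/\ D Y, nm v = 1, nm w = 1, slack r A0 Y v w <= e &
    forall B, List.In B s -> nm (B v - A0 v) <= 2 * e].
Proof.
move=> q0 r0 gD cD rD diametral A0 DA0 e s e0 sD.
have [X DX XP] := iterated_midpoint q0 r0 gD cD rD DA0 sD.
have {XP} [d d0 XP] := XP e e0.
(* The minimum with r keeps the radius r - d' nonnegative. *)
pose d' := Num.min d r.
have [d'0 d'd d'r] : [/\ 0 < d', d' <= d & d' <= r].
  by rewrite /d' lt_min d0 r0 !ge_min !lexx orbT.
have [|Y DY XY] := diametral X (r - d') DX; first by lra.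
have [|v [w [v1 w1 vw]]] := slack_small _ XY; first by lra.
have slackX : slack r X Y v w <= d.
  have -> : slack r X Y v w =
      slack (r - d') X Y v w + d' * (defect X v * defect Y w).
    by rewrite /slack; ring.
  have : d' * (defect X v * defect Y w) <= d' * (1 * 1).
    rewrite ler_wpM2l ?(ltW d'0) // ler_pM ?defect_ge0 //.
      by apply: le_trans (defect_le _ _) _; rewrite ipxx v1 expr1n.
    by apply: le_trans (defect_le _ _) _; rewrite ipxx w1 expr1n.
  lra.
have {}XP := XP Y v w DY v1 w1 slackX.
have [sA0 A0X] := XP A0 (or_introl erefl).
exists Y, v, w; split => // B Bs; have [_ BX] := XP B (or_intror Bs).
rewrite -(subrK (X v) (B v)) -addrA; apply: le_trans (nmD _ _) _.
rewrite (nm_distC (X v)); lra.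
Qed.

(** Every stage adds the witness Y of [diametral_witness] to the list, so that
at a later stage n the vector Y_m v_n is close to A0 v_n for all m < n. When v_m
is close to v_n this contradicts [slack_lower] at stage m. The value of e makes
(1 + 4 (6 + 2 r)) e = r q^2 / 2 for that last comparison. *)
Lemma no_diametral (D : set (unit_ball K H)) (q r : R) :
  0 < q -> 0 < r -> D `<=` gap q -> midconvex D ->
  (forall X Y, D X -> D Y -> sinhsq X Y <= r) ->
  (forall X (s : R), D X -> s < r -> exists2 Y, D Y & s < sinhsq X Y) ->
  D = set0.
Proof.
move=> q0 r0 gD cD rD diametral; apply/seteqP; split => // A0 DA0.
have q2 : 0 < r * q ^+ 2 by rewrite mulr_gt0 ?exprn_gt0.
have c0 : 0 < 2 * (25 + 8 * r) by lra.
pose e := r * q ^+ 2 / (2 * (25 + 8 * r)).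
have e0 : 0 < e by rewrite divr_gt0.
have /choice[F FP] (s : list (unit_ball K H)) :
    exists p : unit_ball K H * K * K, (forall B, List.In B s -> D B) ->
    [/\ D p.1.1, nm p.1.2 = 1, nm p.2 = 1, slack r A0 p.1.1 p.1.2 p.2 <= e &
    forall B, List.In B s -> nm (B p.1.2 - A0 p.1.2) <= 2 * e].
  have [sD|nsD] := pselect (forall B, List.In B s -> D B); last first.
    by exists (A0, 0, 0).
  have [Y [v [w h]]] := diametral_witness q0 r0 gD cD rD diametral DA0 e0 sD.
  by exists (Y, v, w).
pose S n := iter n (fun s => (F s).1.1 :: s) [::].
have SD n B : List.In B (S n) -> D B.
  elim: n B => [//|n IH] B [<-|]; last exact: IH.
  by have [] := FP _ IH.
have SY m n : (m < n)%N -> List.In (F (S m)).1.1 (S n).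
  elim: n => // n IH; rewrite ltnS leq_eqVlt => /orP[/eqP ->|/IH]; first by left.
  by right.
pose v n := (F (S n)).1.2.
have v1 n : nm (v n) = 1 by have [] := FP _ (SD n).
have [|m [n [mn vmn]]] := @unit_sphere_totally_bounded _ _ _ K_findim v e e0.
  by move=> n; rewrite v1.
have [DY _ w1 sl _] := FP _ (SD m).
have [_ _ _ _ /(_ _ (SY _ _ mn))] := FP _ (SD n).
set Y := (F (S m)).1.1 in DY sl *; set w := (F (S m)).2 in w1 sl.
rewrite -/(v n) -/(v m) in sl * => Yn.
have YA : nm (A0 (v m) - Y (v m)) <= 4 * e.
  have E : A0 (v m) - Y (v m) =
      A0 (v m - v n) + ((A0 (v n) - Y (v n)) - Y (v m - v n)).
    rewrite (linB (ball_linear A0)) (linB (ball_linear Y)) opprB.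
    by rewrite [X in _ = _ + X]addrA subrK addrA subrK.
  rewrite E; apply: le_trans (nmD _ _) _.
  have := nmB (A0 (v n) - Y (v n)) (Y (v m - v n)).
  have := nm_ball_le A0 (v m - v n); have := nm_ball_le Y (v m - v n).
  rewrite nm_distC in Yn; lra.
have := slack_lower q0 (ltW r0) _ (gD _ DY) (v1 m) w1 YA.
have -> : r * q ^+ 2 = e * (2 * (25 + 8 * r)) by rewrite mulfVK ?gt_eqF.
have : 0 <= e * r by rewrite mulr_ge0 ?ltW.
move=> er /(_ _) h; have {}h := h (mulr_ge0 (ler0n _ 4) (ltW e0)); nra.
Qed.

Lemma midconvex_normal_structure (D : set (unit_ball K H)) q r :
  0 < q -> D `<=` gap q -> midconvex D -> D !=set0 -> 0 < r ->
  (forall X Y, D X -> D Y -> sinhsq X Y <= r) ->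
  exists X, D X /\ exists2 s, s < r & forall Y, D Y -> sinhsq X Y <= s.
Proof.
move=> q0 gD cD [A0 DA0] r0 rD; apply: contrapT => h.
suff D0 : D = set0 by rewrite D0 in DA0.
apply: (no_diametral q0 r0 gD cD rD) => X s DX sr.
apply: contrapT => h'; apply: h; exists X; split => //; exists s => // Y DY.
by rewrite leNgt; apply/negP => sY; apply: h'; exists Y.
Qed.

End NormalStructure.

(** * An invariant convex set around a bounded orbit *)
Section Asymptotics.
Context (T : Type) (E : set (T -> T)).

Inductive iterate : (T -> T) -> Prop :=
| iterate_id : iterate idfun
| iterate_comp g h : E g -> iterate h -> iterate (g \o h).

Lemma iterate_comp_iterate h h' : iterate h -> iterate h' -> iterate (h \o h').
Proof. by move=> ih ih'; elim: ih => // g k Eg _; exact: iterate_comp. Qed.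

Lemma iterate_stable (F : set T) h : (forall g, E g -> g @` F `<=` F) ->
  iterate h -> forall x, F x -> F (h x).
Proof.
move=> EF; elim=> // g k Eg _ IH x /IH Fx.
by apply: (EF _ Eg); exists (k x).
Qed.

Lemma iterate_commute :
  (forall f g, E f -> E g -> f \o g = g \o f) ->
  forall h h', iterate h -> iterate h' -> h \o h' = h' \o h.
Proof.
move=> com.
have gcom g h : E g -> iterate h -> g \o h = h \o g.
  move=> Eg; elim=> // f k Ef _ IH.
  transitivity (f \o (g \o k)); last by rewrite IH.
  exact (congr1 (fun h => h \o k) (com g f Eg Ef)).
move=> h h' ih ih'; elim: ih => // g k Eg _ IH.
transitivity (g \o (h' \o k)); first by rewrite -IH.
exact (congr1 (fun f => f \o k) (gcom g h' Eg ih')).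
Qed.

End Asymptotics.

Section AsymptoticBall.
Context (R : realType) (k : scalar_kind) (K H : hilbertType R k).
Context (K_findim : finite_dimensional K).
Implicit Types (X Y Z : unit_ball K H).

Lemma gapS q q' X : q <= q' -> gap q' X -> gap q X.
Proof.
by move=> qq gX v; apply: le_trans (gX v); rewrite ler_wpM2r ?ipxx_ge0.
Qed.

Lemma ball_meet_midconvex c : midconvex (ball_meet (@sinhsq _ _ K H) c).
Proof.
move=> X Y N cX cY m p cp.
exact: (sinhsq_ball_midconvex K_findim (cX p cp) (cY p cp) m).
Qed.

Lemma ball_meet_closed (M : set (unit_ball K H)) q c :
  0 < q -> M `<=` gap q -> op_closed M -> centered M c ->
  op_closed (M `&` ball_meet (@sinhsq _ _ K H) c).
Proof.
move=> q0 gM clM cM Z cZ.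
have MZ : M Z by apply: clM => e /cZ[X []]; exists X.
split=> // p cp; apply/ler_addgt0Pr => e e0.
have [L L0 LP] := sinhsq_lipschitz H K_findim q0.
have [X [MX cX] XZ] := cZ _ (divr_gt0 e0 L0).
have := LP _ Z X p.1 (ltW (divr_gt0 e0 L0)) (gM _ MZ) (gM _ MX)
  (gM _ (cM _ cp)) (op_nearC XZ).
rewrite mulrC mulfVK ?gt_eqF // => /le_trans; apply.
by rewrite lerD2r; exact: cX.
Qed.

(** Chains of ball intersections are compact, and ball intersections have
normal structure, because both are closed and convex. *)
Lemma fixed_point_of_midconvex (M : set (unit_ball K H)) q
    (gs : list (unit_ball K H -> unit_ball K H)) :
  0 < q -> M !=set0 -> M `<=` gap q -> midconvex M -> op_closed M ->
  (forall g, List.In g gs ->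
     stable M g /\ forall X Y, sinhsq (g X) (g Y) <= sinhsq X Y) ->
  (forall f g, List.In f gs -> List.In g gs -> f \o g = g \o f) ->
  exists2 X, M X & forall g, List.In g gs -> g X = X.
Proof.
move=> q0 M0 gM cM clM gsP com.
apply: (@common_fixed_point _ _ (@sinhsq _ _ K H)) => //.
- by move=> X Y; exact: sinhsqC.
- by move=> X Y; exact: sinhsq_separated.
- move=> C Ctot [c0 Cc0] CP.
  pose G := [set M `&` ball_meet (@sinhsq _ _ K H) c | c in C].
  have [|||Z ZG] := @midconvex_chain_compact _ _ K H K_findim q G q0.
  + by exists (M `&` ball_meet (@sinhsq _ _ K H) c0); exists c0.
  + move=> _ _ [c Cc <-] [c' Cc' <-].
    by case: (Ctot _ _ Cc Cc') => cc'; [right|left]; apply: setIS; exact: ball_meetS.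
  + move=> _ [c /CP[cMc ne] <-]; split => //.
    * exact: midconvexI cM (@ball_meet_midconvex c).
    * exact: ball_meet_closed gM clM cMc.
    * by move=> X [/gM].
  exists Z; split.
    by have [] := ZG _ (ex_intro2 _ _ c0 Cc0 erefl).
  move=> p [c Cc cp].
  by have [_] := ZG _ (ex_intro2 _ _ c Cc erefl); exact.
- move=> c cMc ne r r0 rD.
  apply: (midconvex_normal_structure K_findim q0 _ _ ne r0 rD).
    by move=> X [/gM].
  exact: midconvexI cM (@ball_meet_midconvex c).
- exists (4 / q ^+ 2) => X Y MX MY.
  by apply: gap_sinhsq => //; exact: gM.
- by move=> g /gsP[sg ng]; split => // X Y _ _.
Qed.

(** The sublevel set at height c of the upper limit of sinh^2 rho(s X0, .) as s
runs through the generated monoid, directed by right multiplication. An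
intersection of balls around the orbit need not be stable under maps that are
not onto. *)
Definition asymptotic_ball (E : set (unit_ball K H -> unit_ball K H))
    (X0 : unit_ball K H) (c : R) : set (unit_ball K H) :=
  [set X | forall e, 0 < e -> exists2 s, iterate E s &
     forall u, iterate E u -> sinhsq (s (u X0)) X <= c + e].

Section Properties.
Context (E : set (unit_ball K H -> unit_ball K H)) (X0 : unit_ball K H) (c : R).
Let M := asymptotic_ball E X0 c.

Lemma asymptotic_ball_stable g : E g ->
  (forall X Y, sinhsq (g X) (g Y) <= sinhsq X Y) -> stable M g.
Proof.
move=> Eg ng X MX e e0; have [s Es sX] := MX e e0.
exists (g \o s); first exact: iterate_comp.
by move=> u Eu; apply: le_trans (ng _ _) _; exact: sX.
Qed.

(** Commutativity provides a common tail: s and t both divide s t. *)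
Lemma asymptotic_ball_midconvex :
  (forall f g, E f -> E g -> f \o g = g \o f) -> midconvex M.
Proof.
move=> com X Y N MX MY m e e0.
have [s Es sX] := MX e e0; have [t Et tY] := MY e e0.
exists (s \o t); first exact: iterate_comp_iterate.
move=> u Eu; apply: (sinhsq_ball_midconvex K_findim _ _ m).
  by apply: (sX (t \o u)); exact: iterate_comp_iterate.
rewrite /= -[s (t _)]/((s \o t) (u X0)) (iterate_commute com Es Et).
by apply: (tY (s \o u)); exact: iterate_comp_iterate.
Qed.

Lemma asymptotic_ball_gap q : 0 < q -> 0 <= c ->
  (forall s, iterate E s -> gap q (s X0)) ->
  M `<=` gap (q ^+ 2 / (4 * (1 + (c + 1)))).
Proof.
move=> q0 c0 gE X /(_ 1 ltr01)[s Es /(_ _ (iterate_id E)) sX].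
by apply: (sinhsq_gap K_findim q0 _ (gE _ Es) sX); rewrite addr_ge0.
Qed.

Lemma asymptotic_ball_closed q : 0 < q ->
  (forall s, iterate E s -> gap q (s X0)) -> M `<=` gap q -> op_closed M.
Proof.
move=> q0 gE gM Z MZ e e0.
have gZ : gap q Z.
  by apply: (@gap_closed _ _ _ _ q Z) => d /MZ[X /gM gX XZ]; exists X.
have [L L0 LP] := sinhsq_lipschitz H K_findim q0.
have e2 : 0 < e / 2 by rewrite divr_gt0.
have d0 := divr_gt0 e2 L0.
have [X MX XZ] := MZ _ d0; have [s Es sX] := MX _ e2.
exists s => // u Eu.
have := LP _ Z X (s (u X0)) (ltW d0) gZ (gM _ MX)
  (gE _ (iterate_comp_iterate Es Eu)) (op_nearC XZ).
rewrite mulrC mulfVK ?gt_eqF //; have := sX u Eu; lra.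
Qed.

End Properties.
End AsymptoticBall.

Lemma finite_set_list (T : Type) (E : set T) : finite_set E ->
  exists s : list T, forall x, E x <-> List.In x s.
Proof.
move=> Efin; have /finite_seqP[s sE] : finite_set (E : set {classic T}) by [].
have sIn (t : seq {classic T}) x : x \in t <-> List.In x t.
  elim: t => // y t IH; rewrite inE; split.
    by move=> /orP[/eqP->|/IH]; [left|right].
  by case=> [->|/IH ->]; rewrite ?eqxx ?orbT.
by exists s => x; rewrite [E]sE; exact: sIn.
Qed.

Theorem theorem4p3 (R : realType) (k : scalar_kind) (K H : hilbertType R k)
    (K_findim : finite_dimensional K)
    (E : set (unit_ball K H -> unit_ball K H))
    (E_finite : finite_set E)
    (E_commute : forall f g, E f -> E g -> f \o g = g \o f)
    (E_nonexpansive : forall g, E g -> rho_nonexpansive g) :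
  (exists X : unit_ball K H, forall g, E g -> g X = X) <->
  (exists F : set (unit_ball K H),
     [/\ F !=set0, invariant_set E F & separated_from_boundary F]).
Proof.
split=> [[X EX]|[F [[X0 FX0] EF [r r1 Fr]]]].
  exists [set X]; split.
  - by exists X.
  - by move=> g Eg _ [_ -> <-]; rewrite EX.
  - by exists (opnorm X) => [|_ ->//]; exact: ball_opnorm.
have [gs gsE] := finite_set_list E_finite.
have ng g : E g -> forall X Y, sinhsq (g X) (g Y) <= sinhsq X Y.
  by move=> Eg X Y; apply: rho_nonexpansive_sinhsq => //; exact: E_nonexpansive.
have r0 : 0 <= r.
  by have /andP[h _] := ball_opnorm_itv X0; exact: le_trans h (Fr _ FX0).
pose q := 1 - r ^+ 2.
have q0 : 0 < q by rewrite subr_gt0 exprn_ilt1.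
have gE s : iterate E s -> gap q (s X0).
  move=> Es; apply: gap_opnorm => //; apply: Fr.
  exact: (iterate_stable EF Es FX0).
pose c := 4 / q ^+ 2.
have c0 : 0 <= c by rewrite divr_ge0 ?exprn_ge0 // ltW.
pose M := asymptotic_ball E X0 c.
pose q' := q ^+ 2 / (4 * (1 + (c + 1))).
have q'0 : 0 < q' by rewrite divr_gt0 ?exprn_gt0 //; lra.
have gM : M `<=` gap q' by exact: asymptotic_ball_gap.
pose p := Num.min q q'.
have p0 : 0 < p by rewrite lt_min q0 q'0.
have gMp : M `<=` gap p.
  by move=> X /gM; apply: gapS; rewrite ge_min lexx orbT.
have [||||||X MX gX] := @fixed_point_of_midconvex _ _ K H K_findim M p gs p0.
- exists X0 => e e0; exists idfun; first exact: iterate_id.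
  move=> u Eu; apply: (@le_trans _ _ c); last by rewrite lerDl ltW.
  by apply: gap_sinhsq => //; [exact: gE|exact: (gE _ (iterate_id E))].
- exact: gMp.
- exact: asymptotic_ball_midconvex.
- apply: (asymptotic_ball_closed K_findim p0) => // s Es.
  by apply: gapS (gE _ Es); rewrite ge_min lexx.
- move=> g /gsE Eg; split; last exact: ng.
  exact: asymptotic_ball_stable (ng _ Eg).
- by move=> f g /gsE Ef /gsE Eg; exact: E_commute.
by exists X => g /gsE; exact: gX.
Qed.
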